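(* Let $\gamma:(-1,1)\to S^n$ be a real-analytic curve with $\gamma(0)=(0,\dots,0,-1)$ and $\gamma'(0)=(1,0,\dots,0)$. Then there exists a unique germ at $0$ of a real-analytic function $u(x)$, $x\in\mathbb{R}^n$, with $u(0)=0$ such that, if $\Sigma\subset\mathbb{R}^{n+1}$ is the graph of $u$ and $G$ is its Gauss map, then the rank of $G$ is equal to one at every point of $\Sigma$ and $G((x^1,0),u(x^1,0))=\gamma(x^1)$.
   Context: $S^n\subset\mathbb{R}^{n+1}$ is the unit sphere. For the graph $\Sigma=\{(x,u(x))\}\subset\mathbb{R}^n\times\mathbb{R}$ of a function $u$, the Gauss map $G:\Sigma\to S^n$ sends $(x,u(x))$ to the unit normal $N(x)/|N(x)|$, where $N(x)=(\partial u/\partial x^1,\dots,\partial u/\partial x^n,-1)$. Here $(x^1,0)$ denotes the point $(x^1,0,\dots,0)\in\mathbb{R}^n$. *)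

(* Defs.v *)
From HB Require Import structures.
From mathcomp Require Import all_boot all_order all_algebra.
From mathcomp Require Import all_classical all_reals all_analysis.
Set Implicit Arguments. Unset Strict Implicit. Unset Printing Implicit Defensive.
Import Order.TTheory GRing.Theory Num.Theory.
Import numFieldNormedType.Exports.
Local Open Scope classical_set_scope.
Local Open Scope ring_scope.

Definition evec (R : realType) (n : nat) (j : 'I_n) : 'rV[R]_n :=
  \row_(k < n) (k == j)%:R.

Definition sqnorm (R : realType) (n : nat) (v : 'rV[R]_n) : R :=
  \sum_(i < n) v 0 i ^+ 2.

Definition homog_part (R : realType) (n : nat) (c : ('I_n -> nat) -> R)
    (a x : 'rV[R]_n) (k : nat) : R :=
  \sum_(al : {ffun 'I_n -> 'I_k.+1} | \sum_(i < n) (al i : nat) == k)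
     c (fun i => (al i : nat)) * \prod_(i < n) (x 0 i - a 0 i) ^+ (al i).

Definition abs_homog_part (R : realType) (n : nat) (c : ('I_n -> nat) -> R)
    (a x : 'rV[R]_n) (k : nat) : R :=
  \sum_(al : {ffun 'I_n -> 'I_k.+1} | \sum_(i < n) (al i : nat) == k)
     `|c (fun i => (al i : nat))| * \prod_(i < n) `|x 0 i - a 0 i| ^+ (al i).

Definition analytic_at (R : realType) (n : nat) (f : 'rV[R]_n -> R)
    (a : 'rV[R]_n) : Prop :=
  exists r : R, 0 < r /\ exists c : ('I_n -> nat) -> R,
    forall x : 'rV[R]_n, `|x - a| < r ->
      (exists l : R, (fun N => \sum_(k < N) abs_homog_part c a x k) @ \oo --> l)
      /\ (fun N => \sum_(k < N) homog_part c a x k) @ \oo --> f x.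

Definition analytic_at1 (R : realType) (g : R -> R) (t0 : R) : Prop :=
  exists r : R, 0 < r /\ exists c : nat -> R,
    forall t : R, `|t - t0| < r ->
      (exists l : R, (fun N => \sum_(k < N) `|c k| * `|t - t0| ^+ k) @ \oo --> l)
      /\ (fun N => \sum_(k < N) c k * (t - t0) ^+ k) @ \oo --> g t.

Definition analytic_sphere_curve (R : realType) (m : nat)
    (gamma : R -> 'rV[R]_m) : Prop :=
  (forall t : R, -1 < t < 1 -> sqnorm (gamma t) = 1) /\
  (forall t : R, -1 < t < 1 -> forall j : 'I_m,
      analytic_at1 (fun s => gamma s 0 j) t).

Definition partial (R : realType) (n : nat) (u : 'rV[R]_n -> R) (i : 'I_n)
    (x : 'rV[R]_n) : R := 'D_(evec R i) u x.

Definition normalN (R : realType) (n : nat) (u : 'rV[R]_n -> R)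
    (x : 'rV[R]_n) : 'rV[R]_n.+1 :=
  \row_(j < n.+1) (match unlift ord_max j with
                   | Some i => partial u i x | None => -1 end).

(* Gauss map of the graph of u, in the graph coordinate x:
   (x, u x) |-> N(x)/|N(x)|. *)
Definition gauss (R : realType) (n : nat) (u : 'rV[R]_n -> R)
    (x : 'rV[R]_n) : 'rV[R]_n.+1 :=
  (Num.sqrt (sqnorm (normalN u x)))^-1 *: normalN u x.

(* Jacobian matrix (size (n+1) x n) of the Gauss map composed with the
   graph parametrization x |-> (x, u x); its rank is the rank of G at
   the point (x, u x) of the graph. *)
Definition gauss_jacobian (R : realType) (n : nat) (u : 'rV[R]_n -> R)
    (x : 'rV[R]_n) : 'M[R]_(n.+1, n) :=
  \matrix_(j < n.+1, i < n) 'D_(evec R i) (fun y => gauss u y 0 j) x.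

Definition on_axis (R : realType) (m : nat) (t : R) : 'rV[R]_m.+1 :=
  t *: evec R (@ord0 m).

(* u, on the ball of radius r about 0 in R^(m+1), is a representative of
   a germ solving the problem for gamma : R -> S^(m+1). *)
Definition is_solution (R : realType) (m : nat) (gamma : R -> 'rV[R]_m.+2)
    (u : 'rV[R]_m.+1 -> R) (r : R) : Prop :=
  [/\ 0 < r,
      u 0 = 0,
      (forall x : 'rV[R]_m.+1, `|x| < r -> analytic_at u x),
      (forall x : 'rV[R]_m.+1, `|x| < r -> \rank (gauss_jacobian u x) = 1%N) &
      (forall t : R, `|t| < r -> gauss u (@on_axis R m t) = gamma t)].

(* Main.v *)
Require Import Defs.
From HB Require Import structures.
From mathcomp Require Import all_boot all_order all_algebra.
From mathcomp Require Import all_classical all_reals all_analysis.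
From mathcomp Require Import ring lra zify.
Import Order.TTheory GRing.Theory Num.Theory.
Import numFieldNormedType.Exports.
Local Open Scope classical_set_scope.
Local Open Scope ring_scope.
Set Implicit Arguments.
Unset Strict Implicit.
Unset Printing Implicit Defensive.

(** Near [0] the Gauss map of the graph of [u] is determined by the gradient of
    [u], and has rank one exactly when the Hessian has.  Let [q] be the gradient
    prescribed on the axis by [gamma], and [b = q' / q_0'].  A rank one Hessian
    makes [b_i := u_{i0} / u_{00}] satisfy the Burgers equations
    [d_j b_i = b_j d_0 b_i], so the gradient is constant along the segments from
    [(t, 0)] in the directions orthogonal to [b(t)]: it is [q(s(x))] with
    [s = \sum_i x_i b_i(s)].  This proves uniqueness.  Conversely
    [u(x) = \sum_i x_i q_i(s(x)) - phi(s(x))] with [phi'(t) = t q_0'(t)] has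
    gradient [q(s(x))] and is a solution.

    The analyticity of [s] rests on one closure property: a pointwise limit of
    sums of power series with uniformly bounded weighted l1-norms is again the
    sum of such a power series.  It applies to the Picard iterates, and it also
    yields products, compositions, recentring and derivatives from the case of
    polynomials. *)

(** Analyticity cannot be passed to limits by sup bounds on a real ball: by Weierstrass
    approximation, uniform limits of polynomials are merely continuous there. A bound on the
    weighted sum of the absolute coefficients does survive pointwise limits, and since the norm on
    row vectors is the max norm it controls every monomial on the ball. The formula for the solution
    is that of an envelope. The hyperplanes with equation [z = \sum_i x_i q_i(t) - phi(t)] are to be
    the tangent hyperplanes of the graph, and stationarity in [t] reads
    [\sum_i x_i q_i'(t) = phi'(t)]. With [phi'(t) = t q_0'(t)] this is the implicit equation for [s]
    after division by [q_0'(t)]. The same equation serves uniqueness: as [b_0 = 1], the vector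
    [x - (t, 0)] is orthogonal to [b(t)] exactly when [t = \sum_i x_i b_i(t)]. Solvability of the
    equation near [0] thus says that the segments issuing from the axis cover a neighbourhood of
    [0]. *)

(** * Limits along filters and the max norm *)

Lemma eq_ler (R : realType) (x y : R) : x = y -> x <= y.
Proof. by move=> ->. Qed.

(** Compactness of [[- B, B]] gives a cluster point, and an ultrafilter converges to its cluster
    points. This produces limits of all coefficients at once, in place of a diagonal extraction of
    subsequences. *)
Lemma bounded_ultra_cvg (R : realType) (T : Type) (U : set_system T)
    (g : T -> R) (B : R) : UltraFilter U ->
  (\forall t \near U, `|g t| <= B) -> exists l : R, g @ U --> l.
Proof.
move=> UU gB.
have PU : ProperFilter U by exact: ultra_proper.
have FA : (g @ U) `[- B, B]%classic.
  by apply: filterS gB => t /=; rewrite in_itv /= ler_norml.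
have [l [_ ll]] := @segment_compact R (- B) B (g @ U) _ FA.
exists l => V Vl.
case: (in_ultra_setVsetC (g @^-1` V) UU) => // UV.
by have [y [? ?]] := ll (~` V) V UV Vl.
Qed.

Lemma cvg_sum_fin (R : realType) (T : Type) (F : set_system T) (FF : Filter F)
    (I : finType) (P : pred I) (g : I -> T -> R) (l : I -> R) :
  (forall i, P i -> g i @ F --> l i) ->
  (fun t => \sum_(i | P i) g i t) @ F --> \sum_(i | P i) l i.
Proof.
move=> H.
rewrite (_ : (fun t => _) = \sum_(i | P i) g i); last first.
  by apply/funext => t; rewrite fct_sumE.
elim/big_ind2 : _ => //; first exact: cvg_cst.
by move=> a b c d ac bd; exact: cvgD.
Qed.

Lemma norm_coord (R : realType) (n : nat) (x : 'rV[R]_n) i : `|x 0 i| <= `|x|.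
Proof.
rewrite [leRHS]/Num.Def.normr /= mx_normrE.
by apply/bigmax_geP; right; exists (0, i).
Qed.

Lemma norm_coord_le (R : realType) (n : nat) (x : 'rV[R]_n) (e : R) :
  0 <= e -> (forall i, `|x 0 i| <= e) -> `|x| <= e.
Proof.
move=> e0 H; rewrite /Num.Def.normr /= mx_normrE; apply/bigmax_leP; split => //=.
by move=> [i j] _ /=; rewrite (ord1 i).
Qed.

(** * Power series with a bounded weighted norm *)

Section Majorized.
Variables (R : realType) (n : nat).
Implicit Types (a x h : 'rV[R]_n) (c : ('I_n -> nat) -> R) (f g : 'rV[R]_n -> R).

(** A multi-index of degree [k] has entries at most [k], so the finite type with values in ['I_k.+1]
    captures all of them; the indexing is that of [homog_part]. *)
Definition coef_sum c (k : nat) : R :=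
  \sum_(al : {ffun 'I_n -> 'I_k.+1} | (\sum_(i < n) (al i : nat) == k)%N)
    `|c (fun i => (al i : nat))|.

(* [f] is on the ball of radius [rho] about [a] the sum of a power series whose
   weighted l1-norm is at most [M]. *)
Definition majorized a (rho M : R) f := exists c,
  (forall N, \sum_(k < N) coef_sum c k * rho ^+ k <= M) /\
  forall x, `|x - a| < rho ->
    (fun N => \sum_(k < N) homog_part c a x k) @ \oo --> f x.

Lemma coef_sum_ge0 c k : 0 <= coef_sum c k.
Proof. exact: sumr_ge0. Qed.

Lemma homog_part_le c a x k (t : R) : `|x - a| <= t ->
  `|homog_part c a x k| <= coef_sum c k * t ^+ k.
Proof.
move=> xat; rewrite /homog_part /coef_sum mulr_suml.
apply: (le_trans (ler_norm_sum _ _ _)); apply: ler_sum => al /eqP sal.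
rewrite normrM ler_wpM2l // normr_prod -[in leRHS]sal -prodrXr.
apply: ler_prod => i _; rewrite normr_ge0 /= normrX.
rewrite lerXn2r ?nnegrE ?(le_trans _ xat) //.
by have := norm_coord (x - a) i; rewrite !mxE => /le_trans ->.
Qed.

(** On the ball of radius [th * rho] a term of degree at least [N] gains a factor [th ^+ N]. The
    bound sees the series only through [M], so it is uniform over a family with a common [M]. *)
Lemma majorized_tail c a (rho M th : R) f x N :
  (forall N, \sum_(k < N) coef_sum c k * rho ^+ k <= M) ->
  (fun N => \sum_(k < N) homog_part c a x k) @ \oo --> f x ->
  0 < rho -> 0 <= th <= 1 -> `|x - a| <= th * rho ->
  `|f x - \sum_(k < N) homog_part c a x k| <= th ^+ N * M.
Proof.
move=> cM cf rho0 /andP[th0 th1] xa.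
have H : (fun K => `|\sum_(k < K) homog_part c a x k
                    - \sum_(k < N) homog_part c a x k|) @ \oo -->
    `|f x - \sum_(k < N) homog_part c a x k|.
  by apply: cvg_norm; apply: cvgB => //; exact: cvg_cst.
apply: (cvgr_to_le H); near=> K.
have NK : (N <= K)%N by near: K; exact: nbhs_infty_ge.
rewrite -(subnKC NK) big_split_ord /= addrAC subrr add0r.
apply: (le_trans (ler_norm_sum _ _ _)).
apply: (@le_trans _ _ (th ^+ N * \sum_(k < K - N)
   (coef_sum c (N + k)%N * rho ^+ (N + k)%N))).
  rewrite mulr_sumr; apply: ler_sum => k _.
  apply: (le_trans (homog_part_le _ _ xa)).
  rewrite exprMn mulrCA ler_wpM2r ?mulr_ge0 ?coef_sum_ge0 ?exprn_ge0 ?(ltW rho0) //.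
  by rewrite exprD ler_piMr ?exprn_ge0 ?exprn_ile1.
rewrite ler_wpM2l ?exprn_ge0 //; apply: le_trans (cM K).
rewrite -[in leRHS](subnKC NK) big_split_ord /= lerDr.
by apply: sumr_ge0 => i _; rewrite mulr_ge0 ?coef_sum_ge0 ?exprn_ge0 ?(ltW rho0).
Unshelve. all: by end_near. Qed.

Lemma majorized_le a (rho M : R) f x : 0 < rho -> majorized a rho M f ->
  `|x - a| < rho -> `|f x| <= M.
Proof.
move=> rho0 [c [cM cf]] xa.
have := @majorized_tail c a rho M 1 f x 0 cM (cf _ xa) rho0.
by rewrite big_ord0 subr0 expr0 !mul1r ler01 lexx (ltW xa); exact.
Qed.

Lemma majorized_ge0 a (rho M : R) f : majorized a rho M f -> 0 <= M.
Proof. by case=> c [/(_ 0%N)]; rewrite big_ord0. Qed.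

(* The coefficients of the limit are the limits of the coefficients along an
   ultrafilter refining [F]. *)
Lemma majorized_lim (T : Type) (F : set_system T) (PF : ProperFilter F)
    a (rho M : R) (F_ : T -> 'rV[R]_n -> R) f :
  0 < rho -> (\forall t \near F, majorized a rho M (F_ t)) ->
  (forall x, `|x - a| < rho -> F_ ^~ x @ F --> f x) -> majorized a rho M f.
Proof.
move=> rho0 FM Ff.
have [U [UU FU]] := ultraFilterLemma PF.
have PU : ProperFilter U by exact: ultra_proper.
(* The default series is met only for those [t] at which [F_ t] is not majorized; by [FM] they do
   not matter along the filter. *)
pose C t : ('I_n -> nat) -> R :=
  if pselect (majorized a rho M (F_ t)) is left H then projT1 (cid H) else fun=> 0.
have CP : \forall t \near U,
    (forall N, \sum_(k < N) coef_sum (C t) k * rho ^+ k <= M) /\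
    forall x, `|x - a| < rho ->
    (fun N => \sum_(k < N) homog_part (C t) a x k) @ \oo --> F_ t x.
  apply: FU; apply: filterS FM => t Ht; rewrite /C.
  by case: pselect => // H; exact: (projT2 (cid H)).
have Ucvg k (al : {ffun 'I_n -> 'I_k.+1}) :
    (\sum_(i < n) (al i : nat) == k)%N ->
    exists l : R, (fun t => C t (fun i => (al i : nat))) @ U --> l.
  move=> sal; apply: (@bounded_ultra_cvg _ _ _ _ (M / rho ^+ k)).
  apply: filterS CP => t [tM _]; rewrite ler_pdivlMr ?exprn_gt0 //.
  apply: le_trans (tM k.+1); rewrite big_ord_recr /=.
  apply: (@le_trans _ _ (coef_sum (C t) k * rho ^+ k)).
    rewrite ler_wpM2r ?exprn_ge0 ?(ltW rho0) // /coef_sum (bigD1 al) //=.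
    by rewrite lerDl sumr_ge0.
  rewrite lerDr; apply: sumr_ge0 => i _.
  by rewrite mulr_ge0 ?coef_sum_ge0 ?exprn_ge0 ?(ltW rho0).
pose c (al : 'I_n -> nat) := lim ((fun t => C t al) @ U).
have cP k (al : {ffun 'I_n -> 'I_k.+1}) :
    (\sum_(i < n) (al i : nat) == k)%N ->
    (fun t => C t (fun i => (al i : nat))) @ U --> c (fun i => (al i : nat)).
  by move=> /Ucvg[l Hl]; rewrite /c (cvg_lim _ Hl).
exists c; split.
  move=> N.
  have H : (fun t => \sum_(k < N) coef_sum (C t) k * rho ^+ k) @ U -->
      \sum_(k < N) coef_sum c k * rho ^+ k.
    apply: cvg_sum_fin => k _; apply: cvgMr_tmp.
    by apply: cvg_sum_fin => al /cP ?; exact: cvg_norm.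
  by apply: (cvgr_to_le H); apply: filterS CP => t [].
move=> x xa.
pose th := `|x - a| / rho.
have th0 : 0 <= th by rewrite divr_ge0 // ltW.
have th1 : th < 1 by rewrite ltr_pdivrMr // mul1r.
(* For fixed [N] only finitely many coefficients occur, so the uniform tail bound passes to the
   limit along [U]; [N] tends to infinity only afterwards. *)
have bnd N : `|f x - \sum_(k < N) homog_part c a x k| <= th ^+ N * M.
  have H : (fun t => `|F_ t x - \sum_(k < N) homog_part (C t) a x k|) @ U -->
      `|f x - \sum_(k < N) homog_part c a x k|.
    apply: cvg_norm; apply: cvgB.
      by apply: cvg_trans (Ff _ xa) => A; exact: FU.
    apply: cvg_sum_fin => k _; apply: cvg_sum_fin => al /cP ?.
    exact: cvgMr_tmp.
  apply: (cvgr_to_le H); apply: filterS CP => t [tM tF].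
  apply: (majorized_tail _ tM (tF _ xa) rho0); first by rewrite th0 ltW.
  by rewrite divfK // gt_eqF.
apply/cvgrPdist_le => e e0.
have : (fun N => th ^+ N * M) @ \oo --> 0 * M.
  by apply: cvgMr_tmp; apply: cvg_expr; rewrite ger0_norm.
rewrite mul0r => /cvgrPdist_le /(_ _ e0); apply: filterS => N.
rewrite sub0r normrN => H.
by apply: (le_trans (bnd N)); apply: le_trans H; exact: ler_norm.
Qed.

Lemma majorized_ext a (rho M : R) f g :
  (forall x, `|x - a| < rho -> f x = g x) ->
  majorized a rho M f -> majorized a rho M g.
Proof.
by move=> fg [c [cM cf]]; exists c; split => // x xa; rewrite -fg //; exact: cf.
Qed.

Lemma majorizedW a (rho M rho' M' : R) f : 0 <= rho' -> rho' <= rho -> M <= M' ->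
  majorized a rho M f -> majorized a rho' M' f.
Proof.
move=> r0 rr MM [c [cM cf]]; exists c; split.
  move=> N; apply: le_trans MM; apply: le_trans (cM N); apply: ler_sum => k _.
  by rewrite ler_wpM2l ?coef_sum_ge0 // lerXn2r ?nnegrE // (le_trans r0).
by move=> x xa; apply: cf; exact: lt_le_trans rr.
Qed.

Lemma majorizedD a (rho M N : R) f g : 0 <= rho ->
  majorized a rho M f -> majorized a rho N g ->
  majorized a rho (M + N) (fun x => f x + g x).
Proof.
move=> r0 [c [cM cf]] [d [dN dg]]; exists (fun al => c al + d al); split.
  move=> K; apply: le_trans (lerD (cM K) (dN K)).
  rewrite -big_split /=; apply: ler_sum => k _.
  rewrite -mulrDl ler_wpM2r ?exprn_ge0 // /coef_sum -big_split /=.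
  by apply: ler_sum => al _; exact: ler_normD.
move=> x xa; rewrite (_ : (fun K => _) = (fun K => \sum_(k < K) homog_part c a x k
   + \sum_(k < K) homog_part d a x k)).
  by apply: cvgD; [exact: cf|exact: dg].
apply/funext => K; rewrite -big_split /=; apply: eq_bigr => k _.
by rewrite /homog_part -big_split /=; apply: eq_bigr => al _; rewrite mulrDl.
Qed.

Lemma cvg_series_const (u : nat -> R) (l : R) (N0 : nat) :
  (forall k, (N0 <= k)%N -> u k = 0) -> \sum_(k < N0) u k = l ->
  (fun N => \sum_(k < N) u k) @ \oo --> l.
Proof.
move=> u0 ul; apply: cvg_near_cst; near=> N.
have NN : (N0 <= N)%N by near: N; exact: nbhs_infty_ge.
rewrite -(subnKC NN) big_split_ord /= ul [X in _ + X]big1 ?addr0 // => i _.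
by rewrite u0 // leq_addr.
Unshelve. all: by end_near. Qed.

Lemma majorized_cst a (rho k : R) : majorized a rho `|k| (fun=> k).
Proof.
pose c (al : 'I_n -> nat) : R := if (\sum_(i < n) al i == 0)%N then k else 0.
have c0 (N : nat) : coef_sum c N = if N == 0%N then `|k| else 0.
  case: N => [|N] /=.
    rewrite /coef_sum (big_pred1 [ffun=> ord0]); last first.
      move=> al /=; rewrite sum_nat_eq0; apply/idP/idP.
        by move=> _; apply/eqP/ffunP => i; rewrite ffunE (ord1 (al i)).
      by move=> /eqP ->; apply/forallP => i; rewrite ffunE.
    by rewrite /c big1 // => i _; rewrite ffunE.
  by rewrite /coef_sum big1 // => al /eqP H; rewrite /c H normr0.
have h0 x (N : nat) : homog_part c a x N = if N == 0%N then k else 0.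
  case: N => [|N] /=.
    rewrite /homog_part (big_pred1 [ffun=> ord0]); last first.
      move=> al /=; rewrite sum_nat_eq0; apply/idP/idP.
        by move=> _; apply/eqP/ffunP => i; rewrite ffunE (ord1 (al i)).
      by move=> /eqP ->; apply/forallP => i; rewrite ffunE.
    rewrite /c big1 /= => [|i _]; last by rewrite ffunE.
    by rewrite big1 ?mulr1 // => i _; rewrite ffunE.
  by rewrite /homog_part big1 // => al /eqP H; rewrite /c H mul0r.
exists c; split.
  case=> [|N]; first by rewrite big_ord0.
  rewrite big_ord_recl c0 /= mulr1 big1 ?addr0 // => i _.
  by rewrite c0 /= mul0r.
move=> x _; apply: (@cvg_series_const _ _ 1%N).
  by case=> // N _; rewrite h0.
by rewrite big_ord1 h0.
Qed.

(** Coefficients of the series multiplied by [x 0 i - a 0 i]. The guard is needed because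
    subtraction on [nat] truncates at zero. *)
Definition shift_coef (i : 'I_n) c : ('I_n -> nat) -> R := fun al =>
  if (0 < al i)%N then c (fun j => (al j - (j == i))%N) else 0.

(** Adding one to entry [i] is a bijection from the multi-indices of degree [k] onto those of degree
    [k.+1] with positive entry [i]; [inord] mediates between the two bounds on the entries. *)
Lemma reindex_shift (i : 'I_n) (k : nat) (G : ('I_n -> nat) -> R) :
  (forall al, al i = 0%N -> G al = 0) ->
  \sum_(al : {ffun 'I_n -> 'I_k.+2} | (\sum_(j < n) (al j : nat) == k.+1)%N)
    G (fun j => (al j : nat)) =
  \sum_(al : {ffun 'I_n -> 'I_k.+1} | (\sum_(j < n) (al j : nat) == k)%N)
    G (fun j => (al j + (j == i))%N).
Proof.
move=> G0.
have sumi (al : 'I_n -> nat) :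
    (\sum_(j < n) (al j + (j == i)) = (\sum_(j < n) al j).+1)%N.
  rewrite big_split /= (bigD1 i) //= [X in (_ + X)%N](bigD1 i) //=.
  by rewrite [X in (_ + (_ + X))%N]big1 ?eqxx; [lia|move=> j /negbTE ->].
have le1 (al : {ffun 'I_n -> 'I_k.+1}) j : (al j + (j == i) < k.+2)%N.
  by have := ltn_ord (al j); case: (j == i); lia.
rewrite (bigID (fun al : {ffun 'I_n -> 'I_k.+2} => (0 < al i)%N)) /=.
rewrite [X in _ + X]big1 ?addr0; last first.
  by move=> al /andP[_]; rewrite lt0n negbK => /eqP ?; exact: G0.
rewrite (reindex_onto
  (fun al : {ffun 'I_n -> 'I_k.+1} => [ffun j => inord (al j + (j == i))] : {ffun 'I_n -> 'I_k.+2})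
  (fun al : {ffun 'I_n -> 'I_k.+2} => [ffun j => inord (al j - (j == i))] : {ffun 'I_n -> 'I_k.+1})) /=;
  last first.
  move=> al /andP[/eqP sal ali]; apply/ffunP => j; rewrite !ffunE.
  apply/val_inj => /=.
  have alj : (al j - (j == i) < k.+1)%N.
    have [->|ji] := eqVneq j i; first by have := ltn_ord (al i); lia.
    move: sal; rewrite (bigD1 i) //= (bigD1 j) //=; lia.
  rewrite inordK ?inordK //.
    have [->|_] := eqVneq j i; lia.
  by have := ltn_ord (al j); have [->|_] := eqVneq j i; lia.
have E (al : {ffun 'I_n -> 'I_k.+1}) j :
    nat_of_ord ([ffun j => inord (al j + (j == i))] j : 'I_k.+2) = (al j + (j == i))%N.
  by rewrite ffunE inordK.
apply: eq_big => [al|al _]; last by congr G; apply/funext => j; rewrite E.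
under eq_bigr do rewrite E.
rewrite sumi eqSS E eqxx addn1 /= andbT.
rewrite [X in _ && X](_ : _ = true) ?andbT //; apply/eqP/ffunP => j.
by rewrite !ffunE inordK // addnK; apply/val_inj; rewrite /= inordK.
Qed.

Lemma coef_sum_shift i c k : coef_sum (shift_coef i c) k.+1 = coef_sum c k.
Proof.
rewrite /coef_sum (@reindex_shift i k (fun al => `|shift_coef i c al|)).
  apply: eq_bigr => al _; rewrite /shift_coef eqxx addn1 /=.
  by congr (`|c _|); apply/funext => j; rewrite addnK.
by move=> al ali; rewrite /shift_coef ali /= normr0.
Qed.

Lemma homog_part_shift i c a x k :
  homog_part (shift_coef i c) a x k.+1 = (x 0 i - a 0 i) * homog_part c a x k.
Proof.
rewrite /homog_part (@reindex_shift i k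
  (fun al => shift_coef i c al * \prod_(j < n) (x 0 j - a 0 j) ^+ al j)).
  rewrite mulr_sumr; apply: eq_bigr => al _.
  rewrite /shift_coef eqxx addn1 /= mulrCA; congr (_ * _).
    by congr c; apply/funext => j; rewrite addnK.
  rewrite (bigD1 i) //= [in RHS](bigD1 i) //= eqxx addn1 exprS -!mulrA.
  congr (_ * (_ * _)); apply: eq_bigr => j /negbTE ->; by rewrite addn0.
by move=> al ali; rewrite /shift_coef ali /= mul0r.
Qed.

Lemma majorizedX i a (rho M : R) f : 0 <= rho -> majorized a rho M f ->
  majorized a rho (rho * M) (fun x => (x 0 i - a 0 i) * f x).
Proof.
move=> r0 [c [cM cf]]; exists (shift_coef i c).
have z (al : {ffun 'I_n -> 'I_1}) : shift_coef i c (fun j => (al j : nat)) = 0.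
  by rewrite /shift_coef (ord1 (al i)).
split.
  case=> [|N]; first by rewrite big_ord0 mulr_ge0 //; have := cM 0%N; rewrite big_ord0.
  rewrite big_ord_recl /= [X in X * _](_ : _ = 0) ?mul0r ?add0r; last first.
    by rewrite /coef_sum big1 // => al _; rewrite z normr0.
  apply: le_trans (ler_wpM2l r0 (cM N)); rewrite mulr_sumr; apply: ler_sum => k _.
  by rewrite coef_sum_shift exprS mulrCA.
move=> x xa; rewrite -cvg_shiftS.
rewrite (_ : (fun N => _) = (fun N => (x 0 i - a 0 i) * \sum_(k < N) homog_part c a x k)).
  by apply: cvgMl_tmp; exact: cf.
apply/funext => N; rewrite big_ord_recl /= [X in X + _](_ : _ = 0) ?add0r; last first.
  by rewrite /homog_part big1 // => al _; rewrite z mul0r.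
by rewrite mulr_sumr; apply: eq_bigr => k _; rewrite homog_part_shift.
Qed.

End Majorized.

(** * Closure properties of analytic functions *)

Section MajorizedAlgebra.
Variables (R : realType) (n : nat).
Implicit Types (a x h v : 'rV[R]_n) (c : ('I_n -> nat) -> R) (f g : 'rV[R]_n -> R).

(** The partial sums are polynomials of weighted norm at most [M], built from constants by sums and
    by multiplication with coordinates. Estimates for linear operations on [f] thus need checking
    only on these and under limits. The bounds [M'] in the limit clause spare [P] from being
    monotone in [M]. *)
Lemma majorized_ind a (rho : R) (P : ('rV[R]_n -> R) -> R -> Prop) :
  (forall k, P (fun=> k) `|k|) ->
  (forall f g M N, P f M -> P g N -> P (fun x => f x + g x) (M + N)) ->
  (forall i f M, P f M -> P (fun x => (x 0 i - a 0 i) * f x) (rho * M)) ->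
  (forall f M (F : nat -> 'rV[R]_n -> R),
     (forall N, exists2 M', M' <= M & P (F N) M') ->
     (forall x, `|x - a| < rho -> F ^~ x @ \oo --> f x) -> P f M) ->
  forall f M, majorized a rho M f -> P f M.
Proof.
move=> Pk PD PX Pl f M [c [cM cf]].
have PXn i k g N : P g N ->
    P (fun x => (x 0 i - a 0 i) ^+ k * g x) (rho ^+ k * N).
  move=> Pg; elim: k => [|k IH].
    by rewrite expr0 mul1r; under eq_fun do rewrite expr0 mul1r.
  by rewrite exprS -mulrA; under eq_fun do rewrite exprS -mulrA; exact: PX.
have Pmon (al : 'I_n -> nat) k s :
    P (fun x => k * \prod_(i <- s) (x 0 i - a 0 i) ^+ al i)
      (`|k| * \prod_(i <- s) rho ^+ al i).
  elim: s => [|i s IH].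
    by rewrite big_nil mulr1; under eq_fun do rewrite big_nil mulr1.
  rewrite big_cons mulrCA; under eq_fun do rewrite big_cons mulrCA; exact: PXn.
have Psum (I : Type) (s : seq I) (Q : pred I) (g : I -> 'rV[R]_n -> R) (N : I -> R) :
    (forall i, Q i -> P (g i) (N i)) ->
    P (fun x => \sum_(i <- s | Q i) g i x) (\sum_(i <- s | Q i) N i).
  move=> H; elim: s => [|i s IH].
    rewrite big_nil; under eq_fun do rewrite big_nil.
    by have := Pk 0; rewrite normr0.
  rewrite big_cons; under eq_fun do rewrite big_cons.
  by case: ifPn => // Qi; apply: PD => //; exact: H.
apply: (Pl _ _ (fun N x => \sum_(k < N) homog_part c a x k)) => // N.
exists (\sum_(k < N) coef_sum c k * rho ^+ k) => //.
apply: (Psum _ _ _ (fun (k : 'I_N) x => homog_part c a x k)) => k _.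
rewrite /coef_sum mulr_suml; apply: (Psum _ _ _ (fun al x => _ * _)) => al /eqP sal.
by rewrite -[X in _ ^+ X]sal -prodrXr; exact: Pmon.
Qed.

Lemma majorizedZ a (rho M k : R) f : majorized a rho M f ->
  majorized a rho (`|k| * M) (fun x => k * f x).
Proof.
move=> [c [cM cf]]; exists (fun al => k * c al); split.
  move=> N; apply: le_trans (ler_wpM2l (normr_ge0 k) (cM N)); rewrite mulr_sumr.
  apply: ler_sum => j _; rewrite mulrA; apply: eq_ler; congr (_ * _).
  by rewrite /coef_sum mulr_sumr; apply: eq_bigr => al _; rewrite normrM.
move=> x xa; rewrite (_ : (fun N => _) = (fun N => k * \sum_(j < N) homog_part c a x j)).
  by apply: cvgMl_tmp; exact: cf.
apply/funext => N; rewrite mulr_sumr; apply: eq_bigr => j _.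
by rewrite /homog_part mulr_sumr; apply: eq_bigr => al _; rewrite mulrA.
Qed.

(** The weighted norm is submultiplicative. Induction on the first factor replaces the Cauchy
    product of two multi-indexed series. *)
Lemma majorizedM a (rho M N : R) f g : 0 < rho ->
  majorized a rho M f -> majorized a rho N g ->
  majorized a rho (M * N) (fun x => f x * g x).
Proof.
move=> r0 fM gN; have N0 := majorized_ge0 gN.
apply: (@majorized_ind a rho (fun f M => majorized a rho (M * N) (fun x => f x * g x)))
  fM => {f M}.
- by move=> k; exact: majorizedZ.
- move=> f1 f2 M1 M2 H1 H2; rewrite mulrDl; under eq_fun do rewrite mulrDl.
  exact: (majorizedD (ltW r0)).
- move=> i f M H; rewrite -mulrA; under eq_fun do rewrite -mulrA.
  exact: (majorizedX _ (ltW r0)).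
- move=> f M F FM Ff.
  apply: (@majorized_lim _ _ _ \oo _ _ _ _ (fun k x => F k x * g x)) => //.
    near=> k; have [M' MM H] := FM k.
    by apply: majorizedW H => //; rewrite ?(ltW r0) // ler_wpM2r.
  by move=> x xa; apply: cvgMr_tmp; exact: Ff.
Unshelve. all: by end_near. Qed.

(** Both bounds go through one induction: the difference for [(x 0 i - a 0 i) * f x] splits by the
    product rule into the difference for [f], times the coordinate, and [h 0 i * f (x + h)]. The
    factor [(rho - rho')^-1] is that of a Cauchy estimate. *)
Lemma majorized_translate a (rho rho' M : R) h f :
  0 < rho' -> rho' < rho -> rho' + `|h| <= rho -> majorized a rho M f ->
  majorized a rho' M (fun x => f (x + h)) /\
  majorized a rho' (`|h| * M / (rho - rho')) (fun x => f (x + h) - f x).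
Proof.
move=> r0 rr rh; have d0 : 0 < rho - rho' by rewrite subr_gt0.
have d0n : rho - rho' != 0 by rewrite gt_eqF.
apply: (@majorized_ind a rho (fun f M => majorized a rho' M (fun x => f (x + h)) /\
  majorized a rho' (`|h| * M / (rho - rho')) (fun x => f (x + h) - f x))) => {f M}.
- move=> k; split; first exact: majorized_cst.
  under eq_fun do rewrite subrr.
  apply: majorizedW (majorized_cst a rho' 0); rewrite ?normr0 ?(ltW r0) //.
  by rewrite divr_ge0 ?mulr_ge0 ?(ltW d0).
- move=> f g M N [f1 f2] [g1 g2]; split; first exact: (majorizedD (ltW r0)).
  rewrite mulrDr mulrDl; under eq_fun do rewrite opprD addrACA.
  exact: (majorizedD (ltW r0)).
- move=> i f M [f1 f2].
  have M0 := majorized_ge0 f1.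
  have hi : `|h 0 i| <= `|h| by exact: norm_coord.
  have H1 : majorized a rho' (`|h| * M) (fun x => h 0 i * f (x + h)).
    by apply: majorizedW (majorizedZ _ f1); rewrite ?(ltW r0) // ler_wpM2r.
  split.
    apply: (@majorized_ext _ _ _ _ _
      (fun x => (x 0 i - a 0 i) * f (x + h) + h 0 i * f (x + h))).
      by move=> x _; rewrite mxE; ring.
    apply: (@majorizedW _ _ _ rho' (rho' * M + `|h| * M)); rewrite ?(ltW r0) //.
      by rewrite -mulrDl ler_wpM2r.
    by apply: majorizedD; rewrite ?(ltW r0) //; apply: majorizedX; rewrite ?(ltW r0).
  apply: (@majorized_ext _ _ _ _ _
      (fun x => (x 0 i - a 0 i) * (f (x + h) - f x) + h 0 i * f (x + h))).
    by move=> x _; rewrite mxE; ring.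
  (* This identity determines the constant: [D := |h| M / (rho - rho')] is the solution of
     [rho * D = rho' * D + |h| M]. *)
  rewrite (_ : _ / _ = rho' * (`|h| * M / (rho - rho')) + `|h| * M); last by field.
  by apply: majorizedD; rewrite ?(ltW r0) //; apply: majorizedX; rewrite ?(ltW r0).
- move=> f M F FM Ff.
  have Ffh x : `|x - a| < rho' -> (fun N => F N (x + h)) @ \oo --> f (x + h).
    move=> xa; apply: Ff; apply: lt_le_trans rh.
    by rewrite addrAC; apply: (le_lt_trans (ler_normD _ _)); rewrite ltrD2r.
  split.
    apply: (@majorized_lim _ _ _ \oo _ _ _ _ (fun k x => F k (x + h))) => //.
    near=> k; have [M' MM [H _]] := FM k.
    by apply: majorizedW H => //; rewrite ltW.
  apply: (@majorized_lim _ _ _ \oo _ _ _ _ (fun k x => F k (x + h) - F k x)) => //.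
    near=> k; have [M' MM [_ H]] := FM k.
    by apply: majorizedW H; rewrite ?(ltW r0) // ler_pM2r ?invr_gt0 // ler_wpM2l.
  move=> x xa; apply: cvgB; first exact: Ffh.
  by apply: Ff; exact: lt_trans rr.
Unshelve. all: by end_near. Qed.

Lemma majorized_recenter a (rho M : R) h f :
  majorized a rho M (fun x => f (x + h)) -> majorized (a + h) rho M f.
Proof.
move=> [c [cM cf]]; exists c; split => // x xa.
have xa' : `|x - h - a| < rho by rewrite -addrA -opprD (addrC h).
have := cf _ xa'; rewrite subrK.
rewrite (_ : (fun N => _) = (fun N => \sum_(k < N) homog_part c (a + h) x k)) //.
apply/funext => N; apply: eq_bigr => k _; apply: eq_bigr => al _; congr (_ * _).
by apply: eq_bigr => i _; rewrite !mxE opprD addrA addrAC.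
Qed.

Lemma majorized_lipschitz a (rho M : R) f x y : 0 < rho -> majorized a rho M f ->
  `|x - a| < rho / 4 -> `|y - a| < rho / 4 ->
  `|f y - f x| <= `|y - x| * (2 * M / rho).
Proof.
move=> r0 fM xa ya.
have yx : `|y - x| <= rho / 2.
  have -> : y - x = (y - a) - (x - a) by rewrite opprB addrA subrK.
  by apply: (le_trans (ler_normB _ _)); lra.
(* Two points in the ball of radius [rho / 4] differ by at most [rho / 2], which is the room left
   for a translation when [rho' = rho / 2]. *)
have [||| _ H] := @majorized_translate a rho (rho / 2) M (y - x) f _ _ _ fM; try lra.
have xa2 : `|x - a| < rho / 2 by lra.
have r2 : 0 < rho / 2 by lra.
have xy : x + (y - x) = y by rewrite addrC subrK.
have := majorized_le r2 H xa2; rewrite /= xy => /le_trans -> //.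
by apply: eq_ler; field; apply/eqP; lra.
Qed.

Lemma sum_le_cvg (u : nat -> R) (M : R) : (forall k, 0 <= u k) ->
  (forall N, \sum_(k < N) u k <= M) ->
  exists l : R, (fun N => \sum_(k < N) u k) @ \oo --> l.
Proof.
move=> u0 uM; apply/cvg_ex; apply: nondecreasing_is_cvgn.
  apply/nondecreasing_seqP => N; by rewrite big_ord_recr /= lerDl.
by exists M => _ [N _ <-].
Qed.

(** Absolute convergence at the single corner [a + (r/2, ..., r/2)] of a smaller max-norm ball
    suffices: there every monomial of degree [k] has absolute value [(r/2)^k], so the absolute
    series is the weighted norm itself. *)
Lemma analytic_atP f a :
  analytic_at f a <-> exists rho M, 0 < rho /\ majorized a rho M f.
Proof.
split.
  move=> [r [r0 [c H]]].
  have r20 : 0 < r / 2 by rewrite divr_gt0.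
  have : `|(a + const_mx (r / 2)) - a| < r.
    rewrite addrC addKr; apply: (@le_lt_trans _ _ (r / 2)); last by lra.
    by apply: norm_coord_le => [|i]; rewrite ?mxE ?gtr0_norm // ltW.
  move=> /H [[l Hl] _]; exists (r / 2), l; split => //; exists c; split.
    have E k : abs_homog_part c a (a + const_mx (r / 2)) k = coef_sum c k * (r / 2) ^+ k.
      rewrite /abs_homog_part /coef_sum mulr_suml; apply: eq_bigr => al /eqP sal.
      congr (_ * _); rewrite -[in RHS]sal -prodrXr; apply: eq_bigr => i _.
      by rewrite !mxE addrAC subrr add0r gtr0_norm.
    move=> N; under eq_bigr do rewrite -E.
    have <- : limn (fun N => \sum_(k < N) abs_homog_part c a (a + const_mx (r / 2)) k) = l.
      exact: cvg_lim Hl.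
    apply: (@nondecreasing_cvgn_le R
      (fun N => \sum_(k < N) abs_homog_part c a (a + const_mx (r / 2)) k)).
      apply/nondecreasing_seqP => K; rewrite big_ord_recr /= lerDl E.
      by rewrite mulr_ge0 ?coef_sum_ge0 ?exprn_ge0 // ltW.
    by apply/cvg_ex; exists l.
  by move=> x xa; have [] // := H x; lra.
move=> [rho [M [r0 [c [cM cf]]]]]; exists rho; split => //; exists c => x xa.
split; last exact: cf.
have ab0 k : 0 <= abs_homog_part c a x k.
  apply: sumr_ge0 => al _; rewrite mulr_ge0 //; apply: prodr_ge0 => i _.
  exact: exprn_ge0.
apply: (@sum_le_cvg _ M) => // N; apply: le_trans (cM N); apply: ler_sum => k _.
rewrite /abs_homog_part /coef_sum mulr_suml; apply: ler_sum => al /eqP sal.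
rewrite ler_wpM2l // -[in leRHS]sal -prodrXr.
apply: ler_prod => i _; rewrite exprn_ge0 //= lerXn2r ?nnegrE ?(ltW r0) //.
by have := norm_coord (x - a) i; rewrite !mxE => /le_trans -> //; exact: ltW.
Qed.

Lemma majorized_analytic a b (rho M : R) f :
  majorized a rho M f -> `|b - a| < rho -> analytic_at f b.
Proof.
move=> fM ba; apply/analytic_atP.
have := normr_ge0 (b - a) => ba0.
have [||| H _] := @majorized_translate a rho ((rho - `|b - a|) / 2) M (b - a) f _ _ _ fM;
  try lra.
exists ((rho - `|b - a|) / 2), M; split; first lra.
by have := majorized_recenter H; rewrite addrC subrK.
Qed.

Lemma analytic_cst (k : R) a : analytic_at (fun=> k) a.
Proof. by apply/analytic_atP; exists 1, `|k|; split => //; exact: majorized_cst. Qed.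

Lemma common_radius f g a : analytic_at f a -> analytic_at g a ->
  exists rho M N, [/\ 0 < rho, majorized a rho M f & majorized a rho N g].
Proof.
move=> /analytic_atP[r [M [r0 fM]]] /analytic_atP[s [N [s0 gN]]].
have rs0 : 0 < Num.min r s by rewrite lt_min r0.
exists (Num.min r s), M, N; split => //.
  by apply: majorizedW fM => //; rewrite ?(ltW rs0) // ge_min lexx.
by apply: majorizedW gN => //; rewrite ?(ltW rs0) // ge_min lexx orbT.
Qed.

Lemma analyticD f g a : analytic_at f a -> analytic_at g a ->
  analytic_at (fun x => f x + g x) a.
Proof.
move=> /common_radius /[apply] -[r [M [N [r0 fM gN]]]].
by apply/analytic_atP; exists r, (M + N); split => //; apply: majorizedD => //; exact: ltW.
Qed.

Lemma analyticM f g a : analytic_at f a -> analytic_at g a ->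
  analytic_at (fun x => f x * g x) a.
Proof.
move=> /common_radius /[apply] -[r [M [N [r0 fM gN]]]].
by apply/analytic_atP; exists r, (M * N); split => //; exact: majorizedM.
Qed.

Lemma analyticZ k f a : analytic_at f a -> analytic_at (fun x => k * f x) a.
Proof. by move=> ?; apply: analyticM => //; exact: analytic_cst. Qed.

Lemma analyticB f g a : analytic_at f a -> analytic_at g a ->
  analytic_at (fun x => f x - g x) a.
Proof.
move=> fa ga; under eq_fun do rewrite -mulN1r.
by apply: analyticD => //; exact: analyticZ.
Qed.

Lemma analytic_sum (I : Type) (s : seq I) (F : I -> 'rV[R]_n -> R) a :
  (forall i, analytic_at (F i) a) -> analytic_at (fun x => \sum_(i <- s) F i x) a.
Proof.
move=> H; elim: s => [|i s IH].
  by under eq_fun do rewrite big_nil; exact: analytic_cst.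
by under eq_fun do rewrite big_cons; exact: analyticD.
Qed.

Lemma majorized_coord i a (rho : R) : 0 <= rho ->
  majorized a rho (`|a 0 i| + rho) (fun x => x 0 i).
Proof.
move=> r0; apply: (@majorized_ext _ _ _ _ _ (fun x => a 0 i + (x 0 i - a 0 i) * 1)).
  by move=> x _; rewrite mulr1 addrC subrK.
apply: majorizedD => //; first exact: majorized_cst.
rewrite -[X in majorized _ _ X _]mulr1 -[X in majorized _ _ (_ * X) _]normr1.
by apply: majorizedX => //; exact: majorized_cst.
Qed.

Lemma analytic_coord i a : analytic_at (fun x => x 0 i) a.
Proof.
by apply/analytic_atP; exists 1, (`|a 0 i| + 1); split => //; exact: majorized_coord.
Qed.

Lemma homog_part0 c a x : homog_part c a x 0 = homog_part c a a 0.
Proof.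
apply: eq_bigr => al _; congr (_ * _); apply: eq_bigr => i _.
by rewrite (ord1 (al i)) !expr0.
Qed.

Lemma homog_partZ c a v (t : R) k :
  homog_part c a (a + t *: v) k = t ^+ k * homog_part c a (a + v) k.
Proof.
rewrite /homog_part mulr_sumr; apply: eq_bigr => al /eqP sal.
rewrite mulrCA; congr (_ * _); rewrite -[X in t ^+ X]sal -prodrXr -big_split /=.
by apply: eq_bigr => i _; rewrite !mxE ![a 0 i + _]addrC !addrK exprMn.
Qed.

(** The tail estimate with [th = 0] and [N = 1] has right-hand side zero. *)
Lemma majorized_center c a (rho M : R) f : 0 < rho ->
  (forall N, \sum_(k < N) coef_sum c k * rho ^+ k <= M) ->
  (fun N => \sum_(k < N) homog_part c a a k) @ \oo --> f a ->
  f a = homog_part c a a 0.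
Proof.
move=> r0 cM ca; have := @majorized_tail _ _ c a rho M 0 f a 1%N cM ca r0.
rewrite subrr normr0 !mul0r lexx ler01 big_ord1 => /(_ erefl erefl).
by rewrite normr_le0 subr_eq0 => /eqP.
Qed.

(** The tail estimate with [N = 2] at [a + h *: v] leaves a remainder quadratic in [h] after the
    constant and linear terms. *)
Lemma majorized_derive c a (rho M : R) f v : 0 < rho ->
  (forall N, \sum_(k < N) coef_sum c k * rho ^+ k <= M) ->
  (forall x, `|x - a| < rho ->
    (fun N => \sum_(k < N) homog_part c a x k) @ \oo --> f x) ->
  is_derive a v f (homog_part c a (a + v) 1).
Proof.
move=> r0 cM cf.
have M0 : 0 <= M by have := cM 0%N; rewrite big_ord0.
have fa : f a = homog_part c a a 0.
  by apply: (majorized_center r0 cM); apply: cf; rewrite subrr normr0.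
(* Adding one keeps [V] positive when [v = 0], so that the conditions on [h] can be written as
   divisions. *)
pose L := homog_part c a (a + v) 1; pose V := `|v| + 1.
have V0 : 0 < V by rewrite ltr_wpDl.
have D0 : 0 < V ^+ 2 * M / rho ^+ 2 + 1.
  by rewrite ltr_wpDl // divr_ge0 ?mulr_ge0 ?exprn_ge0 ?(ltW V0) ?(ltW r0).
suff H : (fun h : R => h^-1 *: ((f \o shift a) (h *: v) - f a)) @ 0^' --> L.
  by apply: DeriveDef; [apply: cvgP H | apply: cvg_lim H].
apply/cvgrPdist_le => e e0; near=> h.
have hn0 : h != 0 by near: h; exact: nbhs_dnbhs_neq.
have hp : 0 < `|h| by rewrite normr_gt0.
have h1 : `|h| * V < rho.
  rewrite -ltr_pdivlMr //; near: h; apply: dnbhs0_lt; exact: divr_gt0.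
have h2 : `|h| * (V ^+ 2 * M / rho ^+ 2) <= e.
  apply: (@le_trans _ _ (`|h| * (V ^+ 2 * M / rho ^+ 2 + 1))).
    by rewrite ler_wpM2l // lerDl.
  rewrite -ler_pdivlMr //; near: h; apply: dnbhs0_le; exact: divr_gt0.
rewrite /= (addrC (h *: v)).
have hva : `|a + h *: v - a| <= `|h| * V.
  by rewrite addrC addKr normrZ ler_wpM2l // lerDl.
have hvr := le_lt_trans hva h1.
have := @majorized_tail _ _ c a rho M (`|h| * V / rho) f (a + h *: v) 2 cM (cf _ hvr) r0.
rewrite divr_ge0 ?mulr_ge0 ?(ltW V0) ?(ltW r0) // ler_pdivrMr // mul1r (ltW h1).
rewrite divfK ?gt_eqF // => /(_ erefl hva).
rewrite big_ord_recr big_ord1 /= homog_part0 -fa homog_partZ expr1 -/L => H.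
rewrite -(ler_pM2l hp).
rewrite [X in L - X](_ : _ = h^-1 * (f (a + h *: v) - f a)) //.
rewrite -normrM mulrBr mulrA mulfV // mul1r -normrN opprB -addrA -opprD.
apply: (le_trans H); apply: le_trans (ler_wpM2l (ltW hp) h2).
apply: eq_ler; field; by rewrite gt_eqF.
Unshelve. all: by end_near. Qed.

Lemma sum_nat_eq1 (al : 'I_n -> nat) : (\sum_(i < n) al i = 1)%N ->
  exists i, forall j, al j = (j == i).
Proof.
move=> sal; have [i ali] : exists i, (0 < al i)%N.
  apply: contrapT => H; move: sal; rewrite big1 // => i _.
  by apply/eqP; rewrite eqn0Ngt; apply/negP => ali; apply: H; exists i.
exists i => j; move: sal; rewrite (bigD1 i) //=.
have [->|ji] := eqVneq j i; first by lia.
by rewrite (bigD1 j) //=; lia.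
Qed.

Lemma homog_part1 c a v :
  homog_part c a (a + v) 1 = \sum_(i < n) v 0 i * c (fun j => (j == i : nat)).
Proof.
pose d (i : 'I_n) : {ffun 'I_n -> 'I_2} := [ffun j => inord (j == i)].
have dE i j : d i j = (j == i) :> nat.
  by rewrite ffunE inordK //; case: (j == i).
have sd i : (\sum_(j < n) (d i j : nat) = 1)%N.
  by rewrite (bigD1 i) //= dE eqxx big1 // => j /negbTE ji; rewrite dE ji.
have dinj : {in predT &, injective d}.
  move=> i j _ _ /ffunP /(_ i) /(congr1 val); rewrite /= !dE eqxx.
  by case: eqVneq.
rewrite /homog_part.
rewrite (eq_bigl (fun al => al \in d @: (@predT 'I_n))); last first.
  move=> al; apply/idP/idP; last by move=> /imsetP[i _ ->]; rewrite sd.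
  move=> /eqP sal; apply/imsetP.
  have [i ali] := sum_nat_eq1 sal.
  by exists i => //; apply/ffunP => j; apply: ord_inj; rewrite dE; exact: ali.
rewrite big_imset //=; apply: eq_bigr => i _; rewrite mulrC; congr (_ * _).
  rewrite (bigD1 i) //= big1 ?mulr1; last by move=> j /negbTE ji; rewrite dE ji.
  by rewrite dE eqxx expr1 mxE addrAC subrr add0r.
by congr c; apply/funext => j; rewrite dE.
Qed.

Lemma analytic_derive f a v : analytic_at f a ->
  is_derive a v f (\sum_(i < n) v 0 i * partial f i a).
Proof.
move=> /analytic_atP[rho [M [r0 [c [cM cf]]]]].
have D w := @majorized_derive c a rho M f w r0 cM cf.
have Di i : partial f i a = c (fun j => (j == i : nat)).
  rewrite /partial (derive_val (is_derive := D _)) homog_part1 (bigD1 i) //= mxE eqxx mul1r.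
  by rewrite big1 ?addr0 // => j /negbTE ji; rewrite mxE ji mul0r.
by under eq_bigr do rewrite Di; rewrite -(homog_part1 c a); exact: D.
Qed.

Lemma analytic_derive_partial f a i : analytic_at f a ->
  is_derive a (evec R i) f (partial f i a).
Proof.
move=> fa; apply: DeriveDef => //.
by have [] := analytic_derive (evec R i) fa.
Qed.

Lemma norm_evec (i : 'I_n) : `|evec R i| <= 1.
Proof.
by apply: norm_coord_le => // j; rewrite mxE; case: (_ == _); rewrite ?normr0 ?normr1.
Qed.

(** By [majorized_translate] with [rho' = rho / 2] the difference quotients are majorized uniformly
    in small [h], so their limit is too; no series is differentiated term by term. *)
Lemma majorized_partial a (rho M : R) f i : 0 < rho -> majorized a rho M f ->
  majorized a (rho / 2) (2 * M / rho) (partial f i).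
Proof.
move=> r0 fM; have M0 := majorized_ge0 fM.
refine (@majorized_lim R n R (dnbhs (0 : R)) _ a (rho / 2) (2 * M / rho)
  (fun (h : R) x => h^-1 * ((f \o shift x) (h *: evec R i) - f x)) (partial f i) _ _ _).
- lra.
- near=> h.
  have hn0 : h != 0 by near: h; exact: nbhs_dnbhs_neq.
  have hr : `|h| <= rho / 2 by near: h; apply: dnbhs0_le; lra.
  have hp : 0 < `|h| by rewrite normr_gt0.
  have he : `|h *: evec R i| <= `|h|.
    by rewrite normrZ ler_piMr // norm_evec.
  have [||| _ H] := @majorized_translate a rho (rho / 2) M (h *: evec R i) f _ _ _ fM;
    try lra.
  apply: (@majorized_ext _ _ _ _ _
      (fun x => h^-1 * (f (x + h *: evec R i) - f x))).
    by move=> x _; rewrite /= [_ + x]addrC.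
  apply: majorizedW (majorizedZ h^-1 H); rewrite ?lexx //; first lra.
  rewrite normfV mulrC ler_pdivrMr // mulrAC.
  rewrite (_ : 2 * M / rho * `|h| = `|h| * (2 * M / rho)); last by ring.
  rewrite (_ : 2 * M / rho = M / (rho - rho / 2)); last by field; apply/eqP; lra.
  rewrite mulrAC -mulrA ler_wpM2r // divr_ge0 //; lra.
- move=> x xa; have fx : analytic_at f x by apply: majorized_analytic fM _; lra.
  by have [D _] := analytic_derive (evec R i) fx; exact: D.
Unshelve. all: by end_near. Qed.

Lemma analytic_partial f a i : analytic_at f a -> analytic_at (partial f i) a.
Proof.
move=> /analytic_atP[rho [M [r0 fM]]]; apply/analytic_atP.
by exists (rho / 2), (2 * M / rho); split; [lra|exact: majorized_partial].
Qed.

Lemma analytic_near f a : analytic_at f a ->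
  exists2 r : R, 0 < r & forall x, `|x - a| < r -> analytic_at f x.
Proof.
move=> /analytic_atP[rho [M [r0 fM]]]; exists rho => // x.
exact: majorized_analytic fM.
Qed.

Lemma analytic_lipschitz f a : analytic_at f a ->
  exists r L : R, [/\ 0 < r, 0 <= L & forall x y, `|x - a| < r -> `|y - a| < r ->
    `|f y - f x| <= `|y - x| * L].
Proof.
move=> /analytic_atP[rho [M [r0 fM]]]; exists (rho / 4), (2 * M / rho).
split; [lra| |by move=> x y; exact: majorized_lipschitz].
by rewrite divr_ge0 ?mulr_ge0 ?(majorized_ge0 fM) // ltW.
Qed.

Lemma nbhs_normrP a (P : set 'rV[R]_n) :
  nbhs a P <-> exists2 e : R, 0 < e & forall x, `|x - a| < e -> P x.
Proof.
split.
  move=> /nbhs_ballP[e /= e0 H]; exists e => // x xa; apply: H.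
  by rewrite mx_norm_ball /ball_ /= distrC.
move=> [e e0 H]; apply/nbhs_ballP; exists e => //= x.
by rewrite mx_norm_ball /ball_ /= distrC; exact: H.
Qed.

End MajorizedAlgebra.

(** * Composition with analytic functions of one variable *)

Section Composition.
Variables (R : realType) (n : nat).
Implicit Types (a x v : 'rV[R]_n) (f : 'rV[R]_n -> R) (g : R -> R).

Lemma analytic_at1_series g (t0 : R) : analytic_at1 g t0 ->
  exists r M (c : nat -> R), [/\ 0 < r, forall N, \sum_(k < N) `|c k| * r ^+ k <= M &
    forall t, `|t| <= r -> (fun N => \sum_(k < N) c k * t ^+ k) @ \oo --> g (t0 + t)].
Proof.
move=> [r [r0 [c H]]].
have E (t : R) : t0 + t - t0 = t by rewrite addrC addKr.
have : `|t0 + r / 2 - t0| < r by rewrite E gtr0_norm; lra.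
move=> /H [[l]]; rewrite E gtr0_norm; last lra; move=> Hl _.
exists (r / 2), l, c; split; first lra.
  move=> N.
  have <- : limn (fun N => \sum_(k < N) `|c k| * (r / 2) ^+ k) = l by exact: cvg_lim Hl.
  apply: (@nondecreasing_cvgn_le R (fun N => \sum_(k < N) `|c k| * (r / 2) ^+ k)).
    apply/nondecreasing_seqP => K; rewrite big_ord_recr /= lerDl.
    by rewrite mulr_ge0 ?exprn_ge0 //; lra.
  by apply/cvg_ex; exists l.
move=> t tr; have /H [_] : `|t0 + t - t0| < r by rewrite E; lra.
by rewrite E.
Qed.

(** If the norm of [f] is at most the radius [r] of the outer series, then [f ^+ k] has norm at most
    [r ^+ k] and the partial sums of the composite are uniformly majorized by [B]. *)
Lemma majorized_comp a (rho r B : R) f g (c : nat -> R) : 0 < rho ->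
  (forall N, \sum_(k < N) `|c k| * r ^+ k <= B) ->
  (forall t, `|t| <= r -> (fun N => \sum_(k < N) c k * t ^+ k) @ \oo --> g t) ->
  majorized a rho r f -> majorized a rho B (fun x => g (f x)).
Proof.
move=> rho0 cB cg fr.
have fk k : majorized a rho (r ^+ k) (fun x => f x ^+ k).
  elim: k => [|k IH].
    by rewrite -[X in majorized _ _ X](@normr1 R); exact: majorized_cst.
  by rewrite exprS; under eq_fun do rewrite exprS; exact: majorizedM.
have fN N : majorized a rho (\sum_(k < N) `|c k| * r ^+ k)
    (fun x => \sum_(k < N) c k * f x ^+ k).
  elim: N => [|N IH].
    rewrite big_ord0; under eq_fun do rewrite big_ord0.
    by rewrite -[X in majorized _ _ X](@normr0 _ R); exact: majorized_cst.
  rewrite big_ord_recr /=; apply: (@majorized_ext _ _ _ _ _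
    (fun x => \sum_(k < N) c k * f x ^+ k + c N * f x ^+ N)).
    by move=> x _; rewrite big_ord_recr.
  by apply: majorizedD; rewrite ?(ltW rho0) //; exact: majorizedZ.
apply: (@majorized_lim R n nat \oo _ _ _ _ (fun N x => \sum_(k < N) c k * f x ^+ k)) => //.
  by near=> N; apply: majorizedW (fN N); rewrite ?(ltW rho0).
by move=> x xa; apply: cg; exact: majorized_le fr xa.
Unshelve. all: by end_near. Qed.

(** Without the constant term every term has degree at least one and gains a factor [rho' / rho] on
    the smaller ball. Shrinking the ball thus makes the norm as small as [majorized_comp]
    requires. *)
Lemma majorized_subcenter a (rho rho' M : R) f : 0 < rho' -> rho' <= rho ->
  majorized a rho M f -> majorized a rho' (rho' / rho * M) (fun x => f x - f a).
Proof.
move=> r0 rr [c [cM cf]].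
have rho0 : 0 < rho by exact: lt_le_trans rr.
pose d (al : 'I_n -> nat) := if (\sum_(i < n) al i == 0)%N then 0 else c al.
have d0 : coef_sum d 0 = 0 by apply: big1 => al H; rewrite /d H normr0.
have dS k : coef_sum d k.+1 = coef_sum c k.+1.
  by apply: eq_bigr => al /eqP H; rewrite /d H.
have h0 x : homog_part d a x 0 = 0 by apply: big1 => al H; rewrite /d H mul0r.
have hS x k : homog_part d a x k.+1 = homog_part c a x k.+1.
  by apply: eq_bigr => al /eqP H; rewrite /d H.
have fa : f a = homog_part c a a 0.
  by apply: (majorized_center rho0 cM); apply: cf; rewrite subrr normr0.
have M0 : 0 <= M by have := cM 0%N; rewrite big_ord0.
exists d; split.
  case=> [|N]; first by rewrite big_ord0 mulr_ge0 // divr_ge0 // ltW.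
  rewrite big_ord_recl d0 mul0r add0r.
  apply: (@le_trans _ _ (rho' / rho * \sum_(k < N) coef_sum c k.+1 * rho ^+ k.+1)).
    rewrite mulr_sumr; apply: ler_sum => k _; rewrite /= /bump /= add1n dS mulrCA.
    rewrite ler_wpM2l ?coef_sum_ge0 // !exprS !mulrA divfK ?gt_eqF //.
    by rewrite ler_wpM2l ?(ltW r0) // lerXn2r ?nnegrE // ltW.
  rewrite ler_wpM2l ?divr_ge0 ?(ltW r0) ?(ltW rho0) //.
  apply: le_trans (cM N.+1); rewrite [leRHS]big_ord_recl lerDr mulr1.
  exact: coef_sum_ge0.
move=> x xa.
have := cf _ (lt_le_trans xa rr).
rewrite -cvg_shiftS => H; rewrite -cvg_shiftS.
rewrite (_ : (fun N => _) = (fun N => \sum_(k < N.+1) homog_part c a x k - f a)).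
  by apply: cvgB => //; exact: cvg_cst.
apply/funext => N; rewrite !big_ord_recl h0 add0r homog_part0 -fa addrAC subrr add0r.
by apply: eq_bigr => k _; rewrite /= /bump /= hS.
Qed.

Lemma analytic_comp g f a : analytic_at1 g (f a) -> analytic_at f a ->
  analytic_at (fun x => g (f x)) a.
Proof.
move=> /analytic_at1_series[r [B [c [r0 cB cg]]]] /analytic_atP[rho [M [rho0 fM]]].
have M0 := majorized_ge0 fM.
have M1 : M + 1 != 0 by rewrite gt_eqF // ltr_wpDl.
(* The second entry makes [rho' / rho * M <= r]; the [+ 1] covers [M = 0]. *)
pose rho' := Num.min rho (rho * r / (M + 1)).
have d0 : 0 < rho * r / (M + 1) by rewrite divr_gt0 ?mulr_gt0 ?ltr_wpDl.
have rho'0 : 0 < rho' by rewrite lt_min rho0.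
have rho'1 : rho' <= rho by rewrite ge_min lexx.
have rho'2 : rho' / rho * M <= r.
  apply: (@le_trans _ _ (rho * r / (M + 1) / rho * M)).
    by rewrite ler_wpM2r // ler_pM2r ?invr_gt0 // ge_min lexx orbT.
  rewrite (_ : _ * M = r * (M / (M + 1))); last first.
    by field; rewrite M1 gt_eqF.
  by rewrite ler_piMr ?(ltW r0) // ler_pdivrMr ?ltr_wpDl // mul1r lerDl.
apply/analytic_atP; exists rho', B; split => //.
apply: (@majorized_ext _ _ _ _ _ (fun x => g (f a + (f x - f a)))).
  by move=> x _; rewrite addrC subrK.
apply: (majorized_comp (g := fun t => g (f a + t)) rho'0 cB cg).
by apply: majorizedW (majorized_subcenter rho'0 rho'1 fM); rewrite ?(ltW rho'0).
Qed.

(** By homogeneity the part of degree [k] restricted to the line is [(t - t0) ^+ k] times its value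
    at [b + v], and these values are the coefficients. *)
Lemma analytic_line f a v (t0 : R) : analytic_at f (a + t0 *: v) ->
  analytic_at1 (fun t => f (a + t *: v)) t0.
Proof.
move=> /analytic_atP[rho [M [rho0 [c [cM cf]]]]].
set b := a + t0 *: v in cf *.
exists (rho / (`|v| + 1)); split; first by rewrite divr_gt0 ?ltr_wpDl.
exists (homog_part c b (b + v)) => t; rewrite ltr_pdivlMr ?ltr_wpDl // => tt0.
have E : a + t *: v = b + (t - t0) *: v by rewrite /b scalerBl addrA addrAC addrK.
have tr : `|b + (t - t0) *: v - b| < rho.
  rewrite [b + _]addrC addrK normrZ; apply: le_lt_trans tt0.
  by rewrite ler_wpM2l // lerDl.
split.
  apply: (@sum_le_cvg R (fun k => `|homog_part c b (b + v) k| * `|t - t0| ^+ k) M) => [k|N].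
    by rewrite mulr_ge0 ?exprn_ge0.
  apply: le_trans (cM N); apply: ler_sum => k _.
  rewrite -normrX -normrM mulrC -homog_partZ.
  exact/homog_part_le/ltW.
rewrite E; have := cf _ tr.
rewrite (_ : (fun N => _) =
  (fun N => \sum_(k < N) homog_part c b (b + v) k * (t - t0) ^+ k)) //.
by apply/funext => N; apply: eq_bigr => k _; rewrite homog_partZ mulrC.
Qed.

End Composition.

(** * Analytic functions of one real variable *)

Section OneVariable.
Variable R : realType.
Implicit Types (g h : R -> R) (t : R).

Lemma analytic_at1P g t :
  analytic_at1 g t <-> analytic_at (fun x : 'rV[R]_1 => g (x 0 0)) (const_mx t).
Proof.
split=> [gt|H].
  by apply: analytic_comp; [rewrite mxE|exact: analytic_coord].
have E : const_mx t = 0 + t *: const_mx 1 :> 'rV[R]_1.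
  by apply/rowP => i; rewrite !mxE add0r mulr1.
move: H; rewrite E => /analytic_line.
by under eq_fun do rewrite !mxE add0r mulr1.
Qed.

Lemma analytic1_near g t : analytic_at1 g t ->
  exists2 r : R, 0 < r & forall s, `|s - t| < r -> analytic_at1 g s.
Proof.
move=> /analytic_at1P /analytic_near[r r0 H]; exists r => // s st.
apply/analytic_at1P; apply: H; apply: le_lt_trans st.
by apply: norm_coord_le => // i; rewrite !mxE.
Qed.

Lemma analytic1_cst (k : R) t : analytic_at1 (fun=> k) t.
Proof. by apply/analytic_at1P; exact: analytic_cst. Qed.

Lemma analytic1_id t : analytic_at1 id t.
Proof. by apply/analytic_at1P; exact: analytic_coord. Qed.

Lemma analytic1M g h t : analytic_at1 g t -> analytic_at1 h t ->
  analytic_at1 (fun s => g s * h s) t.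
Proof.
by move=> /analytic_at1P ? /analytic_at1P ?; apply/analytic_at1P; exact: analyticM.
Qed.

Lemma analytic1_inv t : t != 0 -> analytic_at1 (fun s => s^-1) t.
Proof.
move=> tn0; have t0 : 0 < `|t| by rewrite normr_gt0.
exists (`|t|); split => //.
exists (fun k => t^-1 * (- t^-1) ^+ k) => s st.
have z1 : `|(t - s) / t| < 1.
  by rewrite normrM normfV ltr_pdivrMr // mul1r distrC.
have seriesE (b z : R) : series (geometric b z) = (fun N => \sum_(k < N) b * z ^+ k).
  by apply/funext => N; rewrite /series /= big_mkord.
split.
  exists (`|t^-1| * (1 - `|(t - s) / t|)^-1).
  have := @cvg_geometric_series R `|t^-1| `|(t - s) / t|.
  rewrite normr_id => /(_ z1); rewrite seriesE.
  rewrite (_ : (fun N => _) = (fun N => \sum_(k < N) `|t^-1 * (- t^-1) ^+ k| * `|s - t| ^+ k)) //.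
  apply/funext => N; apply: eq_bigr => k _.
  rewrite (normrM t^-1) normrX normrN -mulrA -exprMn [in LHS]normrM (distrC t).
  by rewrite [`|s - t| * _]mulrC.
have := @cvg_geometric_series R t^-1 ((t - s) / t) z1; rewrite seriesE.
have -> : t^-1 * (1 - (t - s) / t)^-1 = s^-1.
  (* At [s = 0] both sides vanish by the convention [0^-1 = 0]. *)
  have [->|s0] := eqVneq s 0.
    by rewrite subr0 divff // subrr invr0 mulr0.
  by field; rewrite tn0 s0.
rewrite (_ : (fun N => _) = (fun N => \sum_(k < N) t^-1 * (- t^-1) ^+ k * (s - t) ^+ k)) //.
apply/funext => N; apply: eq_bigr => k _; rewrite -mulrA -exprMn; congr (_ * _ ^+ _).
by rewrite mulNr -mulrN opprB mulrC.
Qed.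

Lemma analytic1V g t : g t != 0 -> analytic_at1 g t -> analytic_at1 (fun s => (g s)^-1) t.
Proof.
move=> gt /analytic_at1P ga; apply/analytic_at1P.
apply: (@analytic_comp _ _ (fun s => s^-1)) => //.
by apply: analytic1_inv; rewrite mxE.
Qed.

Lemma analyticV n (f : 'rV[R]_n -> R) a : f a != 0 -> analytic_at f a ->
  analytic_at (fun x => (f x)^-1) a.
Proof.
by move=> fa ?; apply: (@analytic_comp _ _ (fun s => s^-1)) => //; exact: analytic1_inv.
Qed.

Lemma quotient_lift g (x : 'rV[R]_1) :
  (fun h : R => h^-1 *: (((fun y : 'rV[R]_1 => g (y 0 0)) \o shift x) (h *: evec R 0)
     - g (x 0 0))) =
  (fun h : R => h^-1 *: ((g \o shift (x 0 0)) (h *: 1) - g (x 0 0))).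
Proof. by apply/funext => h; rewrite /= !mxE eqxx. Qed.

Lemma analytic1_derive g t : analytic_at1 g t ->
  is_derive t 1 g ('D_1 g t) /\ analytic_at1 ('D_1 g) t.
Proof.
move=> /analytic_at1P ga.
have E x : partial (fun y : 'rV[R]_1 => g (y 0 0)) 0 x = 'D_1 g (x 0 0).
  by rewrite /partial /derive quotient_lift.
split.
  apply: DeriveDef => //.
  have [] := analytic_derive_partial 0 ga.
  by rewrite /derivable quotient_lift mxE.
apply/analytic_at1P; have := analytic_partial 0 ga.
by rewrite (_ : partial _ _ = fun x : 'rV[R]_1 => 'D_1 g (x 0 0)) //; apply/funext.
Qed.

Lemma analytic1_lipschitz g t : analytic_at1 g t ->
  exists r L : R, [/\ 0 < r, 0 <= L & forall x y, `|x - t| < r -> `|y - t| < r ->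
    `|g y - g x| <= `|y - x| * L].
Proof.
move=> /analytic_at1P /analytic_lipschitz[r [L [r0 L0 H]]]; exists r, L; split => // x y xt yt.
have E (u v e : R) : `|u - v| < e -> `|const_mx u - const_mx v : 'rV[R]_1| < e.
  by move=> uv; apply: le_lt_trans uv; apply: norm_coord_le => // i; rewrite !mxE.
have := H (const_mx x) (const_mx y) (E _ _ _ xt) (E _ _ _ yt); rewrite !mxE.
move=> /le_trans; apply; rewrite ler_wpM2r //.
by apply: norm_coord_le => // i; rewrite !mxE.
Qed.

Lemma analytic1_continuous g t : analytic_at1 g t -> {for t, continuous g}.
Proof.
move=> /analytic1_derive[[gd _] _].
by apply: differentiable_continuous; apply/derivable1_diffP.
Qed.

Lemma pseries_cvg (d : nat -> R) (K B : R) : 0 <= K ->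
  (forall N, \sum_(k < N) `|d k| * K ^+ k <= B) -> cvgn (pseries d K).
Proof.
move=> K0 dB; apply: normed_cvg.
rewrite (_ : [normed _] = (fun N => \sum_(k < N) `|d k| * K ^+ k)); last first.
  apply/funext => N; rewrite /normed_series_of /series /= big_mkord.
  by apply: eq_bigr => k _; rewrite normrM normrX (ger0_norm K0).
apply/cvg_ex; apply: (@sum_le_cvg R (fun k => `|d k| * K ^+ k) B) => // k.
by rewrite mulr_ge0 ?exprn_ge0.
Qed.

Lemma analytic1_primitive g : analytic_at1 g 0 -> exists (G : R -> R) (r : R),
  [/\ 0 < r, G 0 = 0, analytic_at1 G 0 &
      forall t, `|t| < r -> is_derive t 1 G (g t)].
Proof.
move=> /analytic_at1_series[r [M [c [r0 cM cg]]]].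
have M0 : 0 <= M by have := cM 0%N; rewrite big_ord0.
pose C k : R := if k is k'.+1 then c k' / k'.+1%:R else 0.
have dC : pseries_diffs C = c.
  by apply/funext => k; rewrite /pseries_diffs /C mulrC divfK // pnatr_eq0.
(* [pseries_snd_diffs] also asks for convergence of the series differentiated twice. At [r / 4] the
   extra factor is absorbed by [k.+1 <= 4 ^ k]. *)
pose K := r / 4; have K0 : 0 < K by rewrite /K; lra.
have K0' := ltW K0.
have Kr k : K ^+ k <= r ^+ k by rewrite lerXn2r ?nnegrE ?(ltW r0) // /K; lra.
have cC : cvgn (pseries C K).
  apply: (@pseries_cvg _ _ (K * M)) => // -[|N]; first by rewrite big_ord0 mulr_ge0.
  rewrite big_ord_recl /= normr0 mul0r add0r.
  apply: le_trans (ler_wpM2l K0' (cM N)); rewrite mulr_sumr; apply: ler_sum => k _.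
  rewrite exprS mulrCA ler_wpM2l //= normrM.
  apply: ler_pM; rewrite ?mulr_ge0 ?exprn_ge0 //.
  by rewrite ler_piMr // ger0_norm ?invr_ge0 // invf_le1 // ler1n.
have cc : cvgn (pseries c K).
  apply: (@pseries_cvg _ _ M) => // N; apply: le_trans (cM N); apply: ler_sum => k _.
  exact: ler_wpM2l.
have cd : cvgn (pseries (pseries_diffs c) K).
  apply: (@pseries_cvg _ _ (M / r)) => // N; rewrite ler_pdivlMr // mulr_suml.
  apply: le_trans (cM N.+1).
  rewrite [leRHS]big_ord_recl /=; apply: ler_wpDl; first by rewrite mulr1.
  apply: ler_sum => k _; rewrite /bump /= add1n /pseries_diffs normrM exprSr mulrA.
  rewrite ler_wpM2r ?(ltW r0) // [X in X * _]mulrC -mulrA ler_wpM2l //.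
  rewrite ger0_norm // /K expr_div_n mulrCA -[leRHS]mulr1 ler_wpM2l ?exprn_ge0 ?(ltW r0) //.
  rewrite ler_pdivrMr ?exprn_gt0 // mul1r -natrX ler_nat.
  exact: ltn_expl.
pose G t := limn (pseries C t).
have KK : `|K| = K by rewrite gtr0_norm.
have Gt t : `|t| < K -> (fun N => \sum_(k < N) C k * t ^+ k) @ \oo --> G t.
  move=> tK; have := is_cvg_pseries_inside cC; rewrite KK => /(_ _ tK).
  rewrite (_ : pseries C t = (fun N => \sum_(k < N) C k * t ^+ k)) //.
    move=> /cvg_ex[l Hl]; rewrite /G /pseries.
    rewrite (_ : series _ = (fun N => \sum_(k < N) C k * t ^+ k)) ?(cvg_lim _ Hl) //.
    by apply/funext => N; rewrite /series /= big_mkord.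
  by apply/funext => N; rewrite /pseries /series /= big_mkord.
exists G, K; split; first exact: K0.
- have := Gt 0; rewrite normr0 => /(_ K0) H.
  have E : G 0 = limn (fun N => \sum_(k < N) C k * 0 ^+ k) by apply/esym/cvg_lim.
  rewrite E; apply: cvg_lim => //.
  apply: (@cvg_series_const R (fun k => C k * 0 ^+ k) 0 0); last by rewrite big_ord0.
  by case=> [|k] _; rewrite ?mul0r // expr0n /= mulr0.
- exists K; split => //; exists C => t; rewrite subr0 => tK; split; last exact: Gt.
  have := is_cvg_pseries_inside_norm cC; rewrite KK => /(_ (`|t|)); rewrite normr_id => /(_ tK).
  rewrite (_ : pseries _ _ = (fun N => \sum_(k < N) `|C k| * `|t| ^+ k)) ; first by move=> /cvg_ex.
  by apply/funext => N; rewrite /pseries /series /= big_mkord.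
- move=> t tK; have := @pseries_snd_diffs _ C K t cC; rewrite dC => /(_ cc cd).
  rewrite KK => /(_ tK); rewrite (_ : limn (pseries c t) = g t) //.
  have tr : `|t| <= r by rewrite /K in tK; lra.
  have := cg _ tr; rewrite add0r => H.
  rewrite (_ : pseries c t = (fun N => \sum_(k < N) c k * t ^+ k)) ?(cvg_lim _ H) //.
  by apply/funext => N; rewrite /pseries /series /= big_mkord.
Qed.

End OneVariable.

(** * Directional derivatives *)

Section Calculus.
Variable R : realType.

Lemma mvt_closed (f df : R -> R) (a b : R) : a < b ->
  (forall x, a <= x <= b -> is_derive x 1 f (df x)) ->
  exists2 c, a < c < b & f b - f a = df c * (b - a).
Proof.
move=> ab D.
have [x xab||c cab E] := @MVT R f df a b ab.
- by apply: D; move: xab; rewrite in_itv /= => /andP[/ltW -> /ltW ->].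
- apply: derivable_within_continuous => x; rewrite in_itv /= => xab.
  by have [] := D _ xab.
by exists c => //; move: cab; rewrite in_itv.
Qed.

Lemma derive0_eq (f : R -> R) :
  (forall x : R, 0 <= x <= 1 -> is_derive x 1 f 0) -> f 1 = f 0.
Proof.
move=> D; have [c _] := @mvt_closed f (fun=> 0) 0 1 ltr01 D.
by rewrite mul0r => /eqP; rewrite subr_eq0 => /eqP.
Qed.

Lemma is_derive_mul (V : normedModType R) (f g : V -> R) x v (df dg : R) :
  is_derive x v f df -> is_derive x v g dg ->
  is_derive x v (fun y => f y * g y) (df * g x + f x * dg).
Proof.
move=> Df Dg; have := is_deriveM Df Dg.
by rewrite /GRing.scale /= addrC [g x * df]mulrC.
Qed.

Lemma is_derive_add (V : normedModType R) (f g : V -> R) x v (df dg : R) :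
  is_derive x v f df -> is_derive x v g dg ->
  is_derive x v (fun y => f y + g y) (df + dg).
Proof. exact: is_deriveD. Qed.

Lemma is_derive_sub (V : normedModType R) (f g : V -> R) x v (df dg : R) :
  is_derive x v f df -> is_derive x v g dg ->
  is_derive x v (fun y => f y - g y) (df - dg).
Proof. exact: is_deriveB. Qed.

Lemma is_derive_bigsum (V : normedModType R) n (f : 'I_n -> V -> R) x v (df : 'I_n -> R) :
  (forall i, is_derive x v (f i) (df i)) ->
  is_derive x v (fun y => \sum_(i < n) f i y) (\sum_(i < n) df i).
Proof.
move=> D; have := is_derive_sum D.
by rewrite (_ : \sum_(i < n) f i = fun y => \sum_(i < n) f i y) //;
  apply/funext => y; rewrite fct_sumE.
Qed.

Lemma is_derive_unique (V : normedModType R) (f : V -> R) x v (d d' : R) :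
  is_derive x v f d -> is_derive x v f d' -> d = d'.
Proof. by move=> [_ <-] [_ <-]. Qed.

Lemma is_derive_line (V : normedModType R) (f : V -> R) (a v : V) (t d : R) :
  is_derive (a + t *: v) v f d <-> is_derive t 1 (fun s => f (a + s *: v)) d.
Proof.
have E : (fun h : R => h^-1 *: ((f \o shift (a + t *: v)) (h *: v) - f (a + t *: v))) =
    (fun h : R => h^-1 *: (((fun s => f (a + s *: v)) \o shift t) (h *: 1)
      - f (a + t *: v))).
  apply/funext => h; rewrite /= [h *: 1]mulr1.
  by rewrite scalerDl addrCA.
split=> -[D1 D2]; apply: DeriveDef.
- by move: D1; rewrite /derivable E.
- by move: D2; rewrite /derive E.
- by rewrite /derivable E.
- by rewrite /derive E.
Qed.

(** Restriction to the line through [x] in direction [v] reduces this to one variable, so only the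
    derivative of [f] along [v] is involved. *)
Lemma is_derive_chain (V : normedModType R) (f : V -> R) (g : R -> R) x v (df dg : R) :
  is_derive x v f df -> is_derive (f x) 1 g dg ->
  is_derive x v (fun y => g (f y)) (dg * df).
Proof.
move=> Df Dg; have x0 : x = x + 0 *: v by rewrite scale0r addr0.
have {Df} /is_derive_line Df : is_derive (x + 0 *: v) v f df by rewrite -x0.
suff : is_derive (x + 0 *: v) v (fun y => g (f y)) (dg * df) by rewrite -x0.
apply/is_derive_line.
apply: (@is_derive1_comp _ g (fun s => f (x + s *: v))) => //.
by rewrite -x0.
Qed.

(** Gronwall's argument: [g ^ 2 * exp (- 2 K t)] has derivative
    [2 (k - K) g ^ 2 exp (- 2 K t) <= 0], starts at zero and is nonnegative. *)
Lemma linear_ode0 (g k : R -> R) (K : R) :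
  (forall t : R, 0 <= t <= 1 -> is_derive t 1 g (k t * g t)) ->
  (forall t : R, 0 <= t <= 1 -> `|k t| <= K) -> g 0 = 0 ->
  forall t : R, 0 <= t <= 1 -> g t = 0.
Proof.
move=> D kK g0 t /andP[]; rewrite le_eqVlt => /predU1P[<- //|t0 t1].
pose e (s : R) := expR (- (2 * K) * s).
have De (s : R) : is_derive s 1 e (e s * - (2 * K)).
  have Dl : is_derive s 1 (fun s => - (2 * K) * s) (- (2 * K)).
    have := is_derive_mul (is_derive_cst (- (2 * K)) s 1) (is_derive_id s 1).
    by rewrite mul0r add0r mulr1.
  exact: (is_derive_chain Dl (is_derive_expR _)).
pose E s := (g s * g s) * e s.
have DE (s : R) : 0 <= s <= t -> is_derive s 1 E
    (2 * (k s - K) * (g s * g s) * e s).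
  move=> /andP[s0 st]; have s01 : 0 <= s <= 1 by rewrite s0 (le_trans st).
  have := is_derive_mul (is_derive_mul (D _ s01) (D _ s01)) (De s).
  by rewrite (_ : _ * e s + _ = 2 * (k s - K) * (g s * g s) * e s) //; ring.
have [c /andP[c0 ct]] := mvt_closed t0 DE.
have c01 : 0 <= c <= 1 by rewrite (ltW c0) (le_trans (ltW ct)).
have gc : 0 <= g c * g c by rewrite -expr2 sqr_ge0.
rewrite {2}/E g0 mul0r mul0r !subr0 => H.
have : E t <= 0.
  rewrite H; rewrite mulr_le0_ge0 ?(ltW t0) // mulr_le0_ge0 ?expR_ge0 //.
  rewrite mulr_le0_ge0 // mulr_ge0_le0 // subr_le0.
  exact: le_trans (ler_norm _) (kK _ c01).
rewrite /E pmulr_lle0 ?expR_gt0 // -expr2 => H2; apply/eqP.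
by rewrite -sqrf_eq0 eq_le H2 sqr_ge0.
Qed.

Lemma common_pos (n : nat) (P : 'I_n -> R -> Prop) :
  (forall i, exists2 r, 0 < r & P i r) ->
  (forall i r r', 0 < r' -> r' <= r -> P i r -> P i r') ->
  exists2 r, 0 < r & forall i, P i r.
Proof.
move=> H W; have /choice[r rP] : forall i, exists r, 0 < r /\ P i r.
  by move=> i; have [r ? ?] := H i; exists r.
pose m := \big[Num.min/1]_(i < n) r i.
have m0 : 0 < m by rewrite /m; elim/big_ind : _ => // [x y x0 y0|i _];
  [rewrite lt_min x0|case: (rP i)].
by exists m => // i; have [_ Pi] := rP i; apply: W Pi => //; exact: bigmin_le_cond.
Qed.

End Calculus.

(** * Symmetry of second partial derivatives *)

Section Schwarz.
Variables (R : realType) (n : nat).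
Implicit Types (a x v : 'rV[R]_n) (f : 'rV[R]_n -> R).

Lemma partial_line f a (i : 'I_n) (t : R) : analytic_at f (a + t *: evec R i) ->
  is_derive t 1 (fun s => f (a + s *: evec R i)) (partial f i (a + t *: evec R i)).
Proof.
move=> fa; have [H _] := is_derive_line f a (evec R i) t (partial f i (a + t *: evec R i)).
by apply: H; exact: analytic_derive_partial.
Qed.

(** The mean value theorem is applied in direction [i] to the difference of [f] along two parallel
    edges, then in direction [j] to [partial f i]. *)
Lemma second_difference f a (i j : 'I_n) (r h : R) : 0 < h -> h + h < r ->
  (forall x, `|x - a| < r -> analytic_at f x) ->
  exists2 y, `|y - a| <= h + h &
   f (a + h *: evec R i + h *: evec R j) - f (a + h *: evec R i)
   - f (a + h *: evec R j) + f a = h * h * partial (partial f i) j y.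
Proof.
move=> h0 hr fa.
have nb (s t : R) : 0 <= s <= h -> 0 <= t <= h ->
    `|a + s *: evec R i + t *: evec R j - a| <= h + h.
  move=> /andP[s0 sh] /andP[t0 th]; rewrite -(addrA a) [a + _]addrC addrK.
  apply: (le_trans (ler_normD _ _)); apply: lerD; rewrite normrZ ger0_norm //.
    by apply: le_trans sh; rewrite ler_piMr // norm_evec.
  by apply: le_trans th; rewrite ler_piMr // norm_evec.
have fan (s t : R) : 0 <= s <= h -> 0 <= t <= h ->
    analytic_at f (a + s *: evec R i + t *: evec R j).
  by move=> sh th; apply: fa; apply: le_lt_trans hr; exact: nb.
have hh : 0 <= h <= h by rewrite lexx ltW.
have h00 : 0 <= (0 : R) <= h by rewrite lexx ltW.
have D1 (t s : R) : 0 <= s <= h -> 0 <= t <= h ->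
    is_derive s 1 (fun s => f (a + s *: evec R i + t *: evec R j))
      (partial f i (a + s *: evec R i + t *: evec R j)).
  move=> sh th.
  have E (s' : R) : a + t *: evec R j + s' *: evec R i = a + s' *: evec R i + t *: evec R j.
    by rewrite addrAC.
  have := @partial_line f (a + t *: evec R j) i s; rewrite E => /(_ (fan _ _ sh th)).
  rewrite (_ : (fun s => f (a + t *: evec R j + s *: evec R i)) =
    (fun s => f (a + s *: evec R i + t *: evec R j))) //.
  by apply/funext => s'; rewrite E.
have D2 (s : R) : 0 <= s <= h -> is_derive s 1
    (fun s => f (a + s *: evec R i + h *: evec R j) - f (a + s *: evec R i + 0 *: evec R j))
    (partial f i (a + s *: evec R i + h *: evec R j)
     - partial f i (a + s *: evec R i + 0 *: evec R j)).
  by move=> sh; apply: is_derive_sub; exact: D1.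
have [c /andP[c0 ch]] := mvt_closed h0 D2.
have chh : 0 <= c <= h by rewrite !ltW.
have D3 (t : R) : 0 <= t <= h -> is_derive t 1
    (fun t => partial f i (a + c *: evec R i + t *: evec R j))
    (partial (partial f i) j (a + c *: evec R i + t *: evec R j)).
  by move=> th; apply: partial_line; apply: analytic_partial; exact: fan.
have [d /andP[d0 dh]] := mvt_closed h0 D3.
have dhh : 0 <= d <= h by rewrite !ltW.
move=> -> ; rewrite !subr0 !scale0r !addr0 => E.
exists (a + c *: evec R i + d *: evec R j); first exact: nb.
rewrite -mulrA [X in h * X]mulrC [RHS]mulrC -E; ring.
Qed.

(** The second difference is symmetric in [i] and [j], so the two mixed derivatives take a common
    value at points within [2 h] of [a]. Both are Lipschitz near [a], so at [a] they differ by at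
    most a multiple of [h]. *)
Lemma partialC f a i j : analytic_at f a ->
  partial (partial f i) j a = partial (partial f j) i a.
Proof.
move=> fa.
have [r r0 fr] := analytic_near fa.
have [r1 [L1 [r10 L10 H1]]] := analytic_lipschitz (analytic_partial j (analytic_partial i fa)).
have [r2 [L2 [r20 L20 H2]]] := analytic_lipschitz (analytic_partial i (analytic_partial j fa)).
set A := partial (partial f i) j in H1 *; set B := partial (partial f j) i in H2 *.
have a0 (e : R) : 0 < e -> `|a - a| < e by rewrite subrr normr0.
have key h : 0 < h -> h + h < Num.min r (Num.min r1 r2) ->
    `|A a - B a| <= h * (2 * (L1 + L2)).
  move=> h0; rewrite !lt_min => /and3P[hr hr1 hr2].
  have [y ya Ey] := @second_difference f a i j r h h0 hr fr.
  have [z za Ez] := @second_difference f a j i r h h0 hr fr.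
  have AB : A y = B z.
    apply: (@mulfI _ (h * h)); first by rewrite mulf_neq0 ?gt_eqF.
    apply: (etrans (esym Ey)); apply: etrans Ez.
    by rewrite (addrAC a (h *: evec R j)); congr (_ + _); exact: addrAC.
  have ya1 := H1 y a (le_lt_trans ya hr1) (a0 _ r10).
  have za1 := H2 a z (a0 _ r20) (le_lt_trans za hr2).
  have -> : A a - B a = (A a - A y) + (B z - B a) by rewrite AB addrA subrK.
  apply: (le_trans (ler_normD _ _)).
  rewrite distrC in ya; rewrite (_ : h * _ = (h + h) * L1 + (h + h) * L2); last by ring.
  by apply: lerD; [apply: le_trans ya1 _|apply: le_trans za1 _]; rewrite ler_wpM2r.
set m := Num.min r _ in key.
have m0 : 0 < m by rewrite !lt_min r0 r10.
apply/eqP; rewrite -subr_eq0 -normr_le0; apply/ler_addgt0Pl => e e0; rewrite addr0.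
pose h := Num.min (m / 4) (e / (2 * (L1 + L2) + 1)).
have L0 : 0 <= 2 * (L1 + L2) by rewrite mulr_ge0 ?addr_ge0.
have L1' : 0 < 2 * (L1 + L2) + 1 by rewrite ltr_wpDl.
have h0 : 0 < h by rewrite lt_min !divr_gt0.
have hm : h <= m / 4 by rewrite ge_min lexx.
apply: (le_trans (key h h0 _)); first lra.
apply: (@le_trans _ _ (h * (2 * (L1 + L2) + 1))); first by rewrite ler_wpM2l ?(ltW h0) // lerDl.
by rewrite -ler_pdivlMr // ge_min lexx orbT.
Qed.

End Schwarz.

(** * The implicit equation of the parameter *)

Section ImplicitParameter.
Variables (R : realType) (n : nat) (b : 'I_n -> R -> R).
Hypothesis b_analytic : forall i, analytic_at1 (b i) 0.

Lemma majorized_sum (a : 'rV[R]_n) (rho : R) (F : 'I_n -> 'rV[R]_n -> R) (M : 'I_n -> R) :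
  0 <= rho -> (forall i, majorized a rho (M i) (F i)) ->
  majorized a rho (\sum_(i < n) M i) (fun x => \sum_(i < n) F i x).
Proof.
move=> r0 FM; elim: (index_enum _) => [|i s IH].
  rewrite big_nil; under eq_fun do rewrite big_nil.
  by rewrite -[X in majorized _ _ X](@normr0 _ R); exact: majorized_cst.
rewrite big_cons; apply: (@majorized_ext _ _ _ _ _ (fun x => F i x + \sum_(j <- s) F j x)).
  by move=> x _; rewrite big_cons.
exact: majorizedD.
Qed.

Lemma uniform_bounds (e : R) : 0 < e -> exists tau (B L : 'I_n -> R) (c : 'I_n -> nat -> R),
  [/\ 0 < tau, tau < e, forall i N, \sum_(k < N) `|c i k| * tau ^+ k <= B i,
   forall i (t : R), `|t| <= tau ->
     (fun N => \sum_(k < N) c i k * t ^+ k) @ \oo --> b i t &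
   forall i, 0 <= L i /\ forall s t : R, `|s| <= tau -> `|t| <= tau ->
     `|b i t - b i s| <= `|t - s| * L i].
Proof.
move=> e0.
pose P i (tau : R) := exists B L (c : nat -> R),
  [/\ forall N, \sum_(k < N) `|c k| * tau ^+ k <= B,
   forall t : R, `|t| <= tau -> (fun N => \sum_(k < N) c k * t ^+ k) @ \oo --> b i t,
   0 <= L & forall s t : R, `|s| <= tau -> `|t| <= tau ->
     `|b i t - b i s| <= `|t - s| * L].
have [i|i r r' r'0 rr|tau tau0 Ptau] := @common_pos R n P.
- have [r [M [c [r0 cM cb]]]] := analytic_at1_series (b_analytic i).
  have [r1 [L [r10 L0 bL]]] := analytic1_lipschitz (b_analytic i).
  exists (Num.min r (r1 / 2)); first by rewrite lt_min r0 divr_gt0.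
  exists M, L, c; split => //.
  + move=> N; apply: le_trans (cM N); apply: ler_sum => k _.
    rewrite ler_wpM2l // lerXn2r ?nnegrE ?(ltW r0) //; last by rewrite ge_min lexx.
    by rewrite le_min (ltW r0) divr_ge0 // ltW.
  + by move=> t; rewrite le_min => /andP[tr _]; have := cb _ tr; rewrite add0r.
  + move=> s t; rewrite !le_min => /andP[_ s1] /andP[_ t1].
    by apply: bL; rewrite subr0; lra.
- move=> [B [L [c [cB cb L0 bL]]]]; exists B, L, c; split => //.
  + move=> N; apply: le_trans (cB N); apply: ler_sum => k _.
    by rewrite ler_wpM2l // lerXn2r ?nnegrE ?(ltW r'0) // (le_trans (ltW r'0)).
  + by move=> t tr; apply: cb; exact: le_trans rr.
  + by move=> s t sr tr; apply: bL; exact: le_trans rr.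
pose tau' := Num.min tau (e / 2).
have tau'0 : 0 < tau' by rewrite lt_min tau0 divr_gt0.
have tau'1 : tau' <= tau by rewrite ge_min lexx.
have tau'2 : tau' <= e / 2 by rewrite ge_min lexx orbT.
have {}/choice[B /choice[L /choice[c H]]] := Ptau.
exists tau', B, L, c; split => //; first by lra.
- move=> i N; have [cB _ _ _] := H i; apply: le_trans (cB N); apply: ler_sum => k _.
  by rewrite ler_wpM2l // lerXn2r ?nnegrE ?(ltW tau'0) // ltW.
- by move=> i t tr; have [_ cb _ _] := H i; apply: cb; exact: le_trans tau'1.
- move=> i; have [_ _ L0 bL] := H i; split => // s t sr tr.
  by apply: bL; exact: le_trans tau'1.
Qed.

(** For small [x] the right-hand side is a contraction in [t] on [[- tau, tau]]. Its Picard iterates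
    have weighted norm at most [tau], hence so has their limit. *)
Lemma implicit_parameter (e : R) : 0 < e -> exists (s : 'rV[R]_n -> R) (r tau : R),
  [/\ 0 < r, 0 < tau < e,
   forall x : 'rV[R]_n, `|x| < r -> analytic_at s x,
   forall x : 'rV[R]_n, `|x| < r -> `|s x| <= tau /\ s x = \sum_(i < n) x 0 i * b i (s x) &
   forall (x : 'rV[R]_n) (t : R), `|x| < r -> `|t| <= tau ->
     t = \sum_(i < n) x 0 i * b i t -> t = s x].
Proof.
move=> /uniform_bounds[tau [B [L [c [tau0 taue cB cb bL]]]]].
have B0 i : 0 <= B i by have := cB i 0%N; rewrite big_ord0.
have L0 i : 0 <= L i by have [] := bL i.
pose Bs := \sum_(i < n) B i; pose Ls := \sum_(i < n) L i.
have Bs0 : 0 <= Bs by exact: sumr_ge0.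
have Ls0 : 0 <= Ls by exact: sumr_ge0.
(* The first entry keeps the norm of the iterates below [tau], the second makes the contraction
   factor [1 / 2]. *)
pose rho := Num.min (tau / (Bs + 1)) ((2 * (Ls + 1))^-1).
have rho0 : 0 < rho by rewrite lt_min divr_gt0 ?ltr_wpDl // invr_gt0 mulr_gt0 // ltr_wpDl.
have rhoB : rho * Bs <= tau.
  apply: (@le_trans _ _ (tau / (Bs + 1) * Bs)).
    by rewrite ler_wpM2r // ge_min lexx.
  by rewrite mulrAC ler_pdivrMr ?ltr_wpDl // ler_wpM2l ?(ltW tau0) // lerDl.
have rhoL : rho * Ls <= 1 / 2.
  apply: (@le_trans _ _ ((2 * (Ls + 1))^-1 * Ls)).
    by rewrite ler_wpM2r // ge_min lexx orbT.
  by rewrite mulrC ler_pdivrMr ?mulr_gt0 ?ltr_wpDl //; lra.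
pose Phi (x : 'rV[R]_n) (t : R) := \sum_(i < n) x 0 i * b i t.
have PhiL (x : 'rV[R]_n) (s t : R) : `|x| < rho -> `|s| <= tau -> `|t| <= tau ->
    `|Phi x t - Phi x s| <= 1 / 2 * `|t - s|.
  move=> xr st tt; rewrite /Phi -sumrB; apply: (le_trans (ler_norm_sum _ _ _)).
  apply: (@le_trans _ _ (rho * Ls * `|t - s|)); last by rewrite ler_wpM2r.
  rewrite /Ls mulr_sumr mulr_suml; apply: ler_sum => i _.
  rewrite -mulrBr normrM -mulrA; apply: ler_pM => //.
    by apply: (le_trans (norm_coord _ _)); exact: ltW.
  by rewrite mulrC; have [_] := bL i; exact.
pose S := fix S k : 'rV[R]_n -> R :=
  if k is k'.+1 then fun x => Phi x (S k' x) else fun=> 0.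
have SM k : majorized 0 rho tau (S k).
  elim: k => [|k IH] /=.
    by apply: majorizedW (majorized_cst 0 rho 0); rewrite ?normr0 ?(ltW rho0) ?(ltW tau0).
  apply: (@majorizedW _ _ _ rho (\sum_(i < n) rho * B i)); rewrite ?(ltW rho0) //.
    by rewrite -mulr_sumr.
  apply: majorized_sum; first exact: ltW.
  move=> i; apply: (@majorized_ext _ _ _ _ _
    (fun x => (x 0 i - (0 : 'rV[R]_n) 0 i) * b i (S k x))).
    by move=> x _; rewrite mxE subr0.
  apply: majorizedX; first exact: ltW.
  exact: (majorized_comp rho0 (cB i) (cb i) IH).
have St k (x : 'rV[R]_n) : `|x| < rho -> `|S k x| <= tau.
  by move=> xr; apply: (majorized_le rho0 (SM k)); rewrite subr0.
have Sd k (x : 'rV[R]_n) : `|x| < rho -> `|S k.+1 x - S k x| <= (1 / 2) ^+ k * tau.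
  move=> xr; elim: k => [|k IH]; first by have := St 1%N x xr; rewrite /= subr0 expr0 mul1r.
  apply: (le_trans (PhiL x (S k x) (S k.+1 x) xr (St _ _ xr) (St _ _ xr))).
  by rewrite exprS; lra.
(* Along an ultrafilter the bounded iterates converge outright; the contraction is needed only to
   show that the limit is a fixed point and the only one. *)
have [U [UU FU]] := ultraFilterLemma (@eventually_filter).
have PU : ProperFilter U by exact: ultra_proper.
have UFilt : Filter U by exact: filter_filter.
pose s x := lim (S ^~ x @ U).
have sP (x : 'rV[R]_n) : `|x| < rho -> S ^~ x @ U --> s x.
  move=> xr; have [|l Hl] := @bounded_ultra_cvg _ _ U (S ^~ x) tau UU.
    by apply: nearW => k; exact: St.
  by rewrite /s (cvg_lim _ Hl).
have sM : majorized 0 rho tau s.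
  apply: (@majorized_lim _ _ _ U _ _ _ _ S) => //; first exact: nearW.
  by move=> x; rewrite subr0; exact: sP.
have st (x : 'rV[R]_n) : `|x| < rho -> `|s x| <= tau.
  by move=> xr; apply: (majorized_le rho0 sM); rewrite subr0.
have uniq (x : 'rV[R]_n) (t t' : R) : `|x| < rho -> `|t| <= tau -> `|t'| <= tau ->
    t = Phi x t -> t' = Phi x t' -> t = t'.
  move=> xr tt tt' E E'; have := PhiL _ _ _ xr tt tt'; rewrite -E -E' => H.
  have : `|t' - t| <= 0 by lra.
  by rewrite normr_le0 subr_eq0 => /eqP.
have sE (x : 'rV[R]_n) : `|x| < rho -> s x = Phi x (s x).
  move=> xr.
  (* An ultrafilter need not be invariant under shifts, so the limit of [S k.+1 x] is reached by
     adding to [S k x] the increment, which tends to zero along [\oo] and hence along [U]. *)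
  have h1 : (fun k => S k x + (S k.+1 x - S k x)) @ U --> s x + 0.
    apply: cvgD; first exact: sP.
    apply: (@cvg_trans _ ((fun k => S k.+1 x - S k x) @ \oo)); first by move=> A; exact: FU.
    apply/cvgrPdist_le => d d0.
    have : (fun N => (1 / 2) ^+ N * tau) @ \oo --> 0 * tau.
      by apply: cvgMr_tmp; apply: cvg_expr; rewrite ger0_norm; lra.
    rewrite mul0r => /cvgrPdist_le /(_ _ d0); apply: filterS => N.
    rewrite !sub0r !normrN => H; apply: (le_trans (Sd _ _ xr)).
    by apply: le_trans H; exact: ler_norm.
  have h2 : (fun k => S k x + (S k.+1 x - S k x)) @ U --> Phi x (s x).
    apply/cvgrPdist_le => d d0.
    have := sP _ xr => /cvgrPdist_le /(_ _ d0); apply: filterS => k H.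
    have -> : S k x + (S k.+1 x - S k x) = Phi x (S k x) by rewrite addrC subrK.
    apply: (le_trans (PhiL x (S k x) (s x) xr (St _ _ xr) (st _ xr))).
    by have := normr_ge0 (s x - S k x); lra.
  by move: h1; rewrite addr0 => h1; exact: (cvg_unique _ h1 h2).
exists s, rho, tau; split; rewrite ?tau0 //.
- by move=> x xr; apply: (majorized_analytic sM); rewrite subr0.
- by move=> x xr; split; [exact: st|exact: sE].
- by move=> x t xr tt E; apply: (uniq x) => //; [exact: st|exact: sE].
Qed.

End ImplicitParameter.

(** * Functions with a gradient of rank one *)

Section Developable.
Variables (R : realType) (m : nat).
Implicit Types (x v : 'rV[R]_m.+1) (t : R).

Lemma analytic_neq0_near n (f : 'rV[R]_n -> R) a : analytic_at f a -> f a != 0 ->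
  exists2 r : R, 0 < r & forall x : 'rV[R]_n, `|x - a| < r -> f x != 0.
Proof.
move=> /analytic_lipschitz[r [L [r0 L0 H]]] fa0.
have fa : 0 < `|f a| by rewrite normr_gt0.
have d0 : 0 < `|f a| / (L + 1) by rewrite divr_gt0 // ltr_wpDl.
exists (Num.min r (`|f a| / (L + 1))); first by rewrite lt_min r0.
move=> x; rewrite lt_min ltr_pdivlMr ?ltr_wpDl // => /andP[xr xf].
apply/eqP => fx0; have := H x a xr; rewrite subrr normr0 fx0 subr0 => /(_ r0).
rewrite distrC => H1.
have : `|x - a| * L <= `|x - a| * (L + 1) by rewrite ler_wpM2l // lerDl.
lra.
Qed.

Lemma analytic1_neq0_near (g : R -> R) (t0 : R) : analytic_at1 g t0 -> g t0 != 0 ->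
  exists2 r : R, 0 < r & forall t, `|t - t0| < r -> g t != 0.
Proof.
move=> /analytic_at1P /analytic_neq0_near; rewrite mxE => H /H [r r0 K]; exists r => // t tr.
have := K (const_mx t); rewrite mxE; apply; apply: le_lt_trans tr.
by apply: norm_coord_le => // i; rewrite !mxE.
Qed.

Lemma is_derive_coord n (x v : 'rV[R]_n) i : is_derive x v (fun y => y 0 i) (v 0 i).
Proof.
have x0 : x = x + 0 *: v by rewrite scale0r addr0.
suff : is_derive (x + 0 *: v) v (fun y : 'rV[R]_n => y 0 i) (v 0 i) by rewrite -x0.
have [_] := is_derive_line (fun y : 'rV[R]_n => y 0 i) x v 0 (v 0 i); apply.
have := is_derive_add (is_derive_cst (x 0 i) (0 : R) 1)
  (is_derive_mul (is_derive_id (0 : R) 1) (is_derive_cst (v 0 i) (0 : R) 1)).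
rewrite /cst mulr0 addr0 add0r mul1r.
by rewrite (_ : (fun y : R => _) = (fun s : R => (x + s *: v) 0 i)) //;
  apply/funext => s; rewrite !mxE.
Qed.

Lemma norm_on_axis t : `|@on_axis R m t| <= `|t|.
Proof. by rewrite /on_axis normrZ ler_piMr // norm_evec. Qed.

Lemma on_axisE t i : @on_axis R m t 0 i = t * (i == ord0)%:R.
Proof. by rewrite !mxE. Qed.

Variable q : 'I_m.+1 -> R -> R.
Hypothesis q_analytic : forall i, analytic_at1 (q i) 0.
Hypothesis q0'0 : 'D_1 (q ord0) 0 = 1.

(** These are the [b_i] along the axis; [slope ord0 t] is [1] wherever ['D_1 (q ord0) t] is
    nonzero. *)
Definition slope i t := 'D_1 (q i) t / 'D_1 (q ord0) t.

Lemma slope_analytic i : analytic_at1 (slope i) 0.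
Proof.
have A j : analytic_at1 ('D_1 (q j)) 0 by have [] := analytic1_derive (q_analytic j).
apply: analytic1M; first exact: A.
by apply: analytic1V; [rewrite q0'0 oner_neq0|exact: A].
Qed.

Lemma q_near : exists2 e : R, 0 < e & forall t, `|t| < e ->
  'D_1 (q ord0) t != 0 /\ forall i, analytic_at1 (q i) t.
Proof.
have [i|i r r' r'0 rr H|e e0 H] :=
  @common_pos R m.+1 (fun i r => forall t, `|t| < r -> analytic_at1 (q i) t).
- have [r r0 H] := analytic1_near (q_analytic i); exists r => // t tr.
  by apply: H; rewrite subr0.
- by move=> t tr; apply: H; exact: lt_le_trans rr.
have [_ /analytic1_neq0_near] := analytic1_derive (q_analytic ord0).
rewrite q0'0 oner_neq0 => /(_ isT)[d d0 Hd].
exists (Num.min e d); first by rewrite lt_min e0.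
move=> t; rewrite lt_min => /andP[te td]; split; first by apply: Hd; rewrite subr0.
by move=> i; exact: H.
Qed.

Lemma developable_exists (e0 : R) : 0 < e0 ->
  exists (u s : 'rV[R]_m.+1 -> R) (r : R),
  [/\ 0 < r, u 0 = 0,
   forall x, `|x| < r -> [/\ analytic_at u x, analytic_at s x, `|s x| < e0 &
     partial s ord0 x != 0],
   forall x j, `|x| < r -> partial u j x = q j (s x) &
   forall t, `|t| < r -> s (@on_axis R m t) = t].
Proof.
move=> e00; have [e1 e10 qe] := q_near.
have idq : analytic_at1 (fun t => t * 'D_1 (q ord0) t) 0.
  apply: analytic1M; first exact: analytic1_id.
  by have [] := analytic1_derive (q_analytic ord0).
have [G [e2 [e20 G0 Ga Gd]]] := analytic1_primitive idq.
have [e3 e30 Gan] := analytic1_near Ga.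
pose e := Num.min (Num.min e0 e1) (Num.min e2 e3).
have ee : 0 < e by rewrite !lt_min e00 e10 e20.
have [s [r [tau [r0 /andP[tau0 taue] sa sE su]]]] := implicit_parameter slope_analytic ee.
have small t : `|t| <= tau -> [/\ `|t| < e0, `|t| < e1, `|t| < e2 & `|t| < e3].
  by move=> /le_lt_trans /(_ taue); rewrite !lt_min => /andP[/andP[-> ->] /andP[-> ->]].
have s0 : s 0 = 0.
  have z : `|0 : 'rV[R]_m.+1| < r by rewrite normr0.
  have [_ ->] := sE _ z.
  by rewrite big1 // => i _; rewrite mxE mul0r.
have axis t : `|t| < Num.min r tau -> s (@on_axis R m t) = t.
  rewrite lt_min => /andP[tr /ltW tt]; apply/esym; apply: su => //.
    by apply: le_lt_trans tr; exact: norm_on_axis.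
  rewrite (bigD1 ord0) //= big1 ?addr0; last first.
    by move=> i /negbTE i0; rewrite on_axisE i0 mulr0 mul0r.
  have [_ te1 _ _] := small _ tt; have [qt _] := qe _ te1.
  by rewrite on_axisE eqxx mulr1 /slope divff // mulr1.
have rt0 : 0 < Num.min r tau by rewrite lt_min r0.
have sa0 : analytic_at s 0 by apply: sa; rewrite normr0.
(* Follows from [s (t, 0) = t]. A nonzero derivative of [s] is what later keeps the rank of the
   Gauss map from dropping to zero. *)
have ds0 : partial s ord0 0 = 1.
  have E0 : 0 + 0 *: evec R ord0 = 0 :> 'rV[R]_m.+1 by rewrite scale0r addr0.
  have := @partial_line R m.+1 s 0 ord0 0; rewrite E0 => /(_ sa0) D1.
  apply: (is_derive_unique D1); apply: near_eq_is_derive (is_derive_id (0 : R) 1).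
  apply/nbhs_ballP; exists (Num.min r tau) => //= t; rewrite /ball /= sub0r normrN => tr.
  by rewrite add0r -/(on_axis _ _) axis.
have [r1 r10 ds] : exists2 r1 : R, 0 < r1 & forall x, `|x - 0| < r1 -> partial s ord0 x != 0.
  by apply: analytic_neq0_near; [exact: analytic_partial|rewrite ds0 oner_neq0].
pose u x := \sum_(i < m.+1) x 0 i * q i (s x) - G (s x).
pose rr := Num.min (Num.min r tau) r1.
have rrP x : `|x| < rr -> `|x| < r /\ `|x| < r1.
  by rewrite !lt_min => /andP[/andP[-> _] ->].
exists u, s, rr; split.
- by rewrite lt_min rt0.
- by rewrite /u s0 G0 subr0 big1 // => i _; rewrite mxE mul0r.
- move=> x /rrP[xr xr1]; have [st _] := sE _ xr; have [se0 se1 se2 se3] := small _ st.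
  split => //; [|exact: sa|by apply: ds; rewrite subr0].
  apply: analyticB.
    apply: analytic_sum => i; apply: analyticM; first exact: analytic_coord.
    apply: analytic_comp; last exact: sa.
    by have [_] := qe _ se1; exact.
  apply: analytic_comp; last exact: sa.
  by apply: Gan; rewrite subr0.
- move=> x j /rrP[xr _]; have [st sx] := sE _ xr; have [_ se1 se2 _] := small _ st.
  have [q0n qa] := qe _ se1.
  have Ds : is_derive x (evec R j) s (partial s j x).
    by apply: analytic_derive_partial; exact: sa.
  have Dq i : is_derive x (evec R j) (fun y => q i (s y)) ('D_1 (q i) (s x) * partial s j x).
    by apply: is_derive_chain => //; have [] := analytic1_derive (qa i).
  have DG := is_derive_chain Ds (Gd _ se2).
  have D := is_derive_sub (is_derive_bigsum (fun i =>
    is_derive_mul (is_derive_coord x (evec R j) i) (Dq i))) DG.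
  rewrite /partial (derive_val (is_derive := D)) big_split /= (bigD1 j) //= big1; last first.
    by move=> i /negbTE ij; rewrite mxE ij mul0r.
  rewrite mxE eqxx mul1r addr0.
  (* By the implicit equation the terms carrying [partial s j x] sum to what the derivative of
     [G (s x)] contributes, so only [q j (s x)] remains. *)
  have -> : \sum_(i < m.+1) x 0 i * ('D_1 (q i) (s x) * partial s j x) =
      s x * 'D_1 (q ord0) (s x) * partial s j x.
    rewrite [X in _ = X * _ * _]sx !mulr_suml; apply: eq_bigr => i _; rewrite /slope.
    by rewrite -!mulrA mulKf.
  by rewrite addrK.
- by move=> t; rewrite lt_min => /andP[tr _]; exact: axis.
Qed.

Lemma partial_near_eq (f g : 'rV[R]_m.+1 -> R) (r : R) x j :
  (forall y : 'rV[R]_m.+1, `|y| < r -> f y = g y) -> `|x| < r ->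
  partial f j x = partial g j x.
Proof.
move=> fg xr; apply: near_eq_derive; apply/nbhs_normrP.
exists (r - `|x|); first by rewrite subr_gt0.
move=> y yx; apply: fg; rewrite -(subrK x y); apply: (le_lt_trans (ler_normD _ _)).
by rewrite -ltrBrDr.
Qed.

Lemma analytic_line_derive n (f : 'rV[R]_n -> R) (a w : 'rV[R]_n) t :
  analytic_at f (a + t *: w) ->
  is_derive t 1 (fun s => f (a + s *: w)) (\sum_(i < n) w 0 i * partial f i (a + t *: w)).
Proof.
move=> fa; have [H _] := is_derive_line f a w t (\sum_(i < n) w 0 i * partial f i (a + t *: w)).
by apply: H; exact: analytic_derive.
Qed.

Lemma partial_axis (f : 'rV[R]_m.+1 -> R) (g : R -> R) (r : R) t :
  (forall x, `|x| < r -> analytic_at f x) ->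
  (forall s : R, `|s| < r -> f (@on_axis R m s) = g s) -> `|t| < r ->
  partial f ord0 (@on_axis R m t) = 'D_1 g t.
Proof.
move=> fa fg tr.
have E (s : R) : 0 + s *: evec R ord0 = @on_axis R m s by rewrite add0r.
have axr : `|@on_axis R m t| < r by exact: le_lt_trans (norm_on_axis t) tr.
have := @partial_line R m.+1 f 0 ord0 t; rewrite E => /(_ (fa _ axr)) [_ <-].
apply: near_eq_derive; apply/nbhs_ballP; exists (r - `|t|); rewrite /= ?subr_gt0 // => s.
rewrite /ball /= distrC => st; rewrite E fg // -(subrK t s).
by apply: (le_lt_trans (ler_normD _ _)); rewrite -ltrBrDr.
Qed.

(** * Constancy of the gradient along characteristic segments *)

Section Characteristics.
Variables (u : 'rV[R]_m.+1 -> R) (r : R).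
Hypothesis r0 : 0 < r.
Hypothesis u_analytic : forall x, `|x| < r -> analytic_at u x.
Hypothesis hess_rank1 : forall x, `|x| < r -> exists beta delta : 'I_m.+1 -> R,
  forall i j, partial (partial u i) j x = beta j * delta i.
Hypothesis hess_neq0 : forall x, `|x| < r -> partial (partial u ord0) ord0 x != 0.

(* Variables rather than definitions, so that unification cannot unfold the
   derivatives. *)
Variables (H : 'I_m.+1 -> 'I_m.+1 -> 'rV[R]_m.+1 -> R) (b : 'I_m.+1 -> 'rV[R]_m.+1 -> R).
Hypothesis H_def : forall i j, H i j = partial (partial u i) j.
Hypothesis b_def : forall i, b i = fun x => H i ord0 x / H ord0 ord0 x.

Let Hn0 x : `|x| < r -> H ord0 ord0 x != 0.
Proof. by rewrite H_def; exact: hess_neq0. Qed.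

Let Ha i j x : `|x| < r -> analytic_at (H i j) x.
Proof.
by move=> xr; rewrite H_def; do 2 apply: analytic_partial; exact: u_analytic.
Qed.

Let ba i x : `|x| < r -> analytic_at (b i) x.
Proof.
move=> xr; rewrite b_def; apply: analyticM; first exact: Ha.
by apply: analyticV; [exact: Hn0|exact: Ha].
Qed.

Let HC i j x : `|x| < r -> H i j x = H j i x.
Proof. by move=> xr; rewrite !H_def; apply: partialC; exact: u_analytic. Qed.

Let H0 i x : `|x| < r -> H i ord0 x = H ord0 ord0 x * b i x.
Proof. by move=> xr; rewrite b_def mulrC divfK //; exact: Hn0. Qed.

(** The minor of the Hessian on rows [0, i] and columns [0, j] vanishes by the rank one
    factorization; symmetry then brings it to this form. *)
Let HE i j x : `|x| < r -> H i j x = (H ord0 ord0 x * b j x) * b i x.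
Proof.
move=> xr; rewrite -(H0 j xr); apply: (mulfI (Hn0 xr)).
rewrite mulrCA -(H0 i xr) (HC j ord0 xr).
have [be [de E]] := hess_rank1 xr.
have {}E k l : H k l x = be l * de k by rewrite H_def; exact: E.
by rewrite !E; ring.
Qed.

(* The Burgers equation of the direction field [b]: compare the two ways of
   differentiating [H i 0] and [H i j] given by Schwarz' theorem. *)
Let burgers i j x : `|x| < r -> partial (b i) j x = b j x * partial (b i) ord0 x.
Proof.
move=> xr; have pa k : analytic_at (partial u k) x.
  by apply: analytic_partial; exact: u_analytic.
have Db k l : is_derive x (evec R l) (b k) (partial (b k) l x).
  by apply: analytic_derive_partial; exact: ba.
have DH k l : is_derive x (evec R l) (H k ord0) (partial (H k ord0) l x).
  by apply: analytic_derive_partial; exact: Ha.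
have E1 : partial (H i ord0) j x =
    partial (H ord0 ord0) j x * b i x + H ord0 ord0 x * partial (b i) j x.
  have [_ E] := is_derive_mul (DH ord0 j) (Db i j); rewrite -E.
  by apply: (@partial_near_eq _ _ r) => // y; exact: H0.
have E2 : partial (H i j) ord0 x =
    partial (H j ord0) ord0 x * b i x + H j ord0 x * partial (b i) ord0 x.
  have [_ E] := is_derive_mul (DH j ord0) (Db i ord0); rewrite -E.
  by apply: (@partial_near_eq _ _ r) => // y yr; rewrite (H0 j yr); exact: HE.
have SC k : partial (H k ord0) j x = partial (H k j) ord0 x.
  by rewrite !H_def; exact: (partialC ord0 j (pa k)).
have E4 : partial (H ord0 ord0) j x = partial (H j ord0) ord0 x.
  apply: (etrans (SC ord0)); apply: (@partial_near_eq _ _ r) => // y; exact: HC.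
have := SC i; rewrite E1 E2 E4 => /addrI; rewrite (H0 j xr) -mulrA.
by move/(mulfI (Hn0 xr)).
Qed.

(** Supplies the constant that [linear_ode0] needs, uniformly over all segments near [0]. *)
Let bounded_speed : exists2 d : R, 0 < d <= r & exists K : 'I_m.+1 -> R,
  forall i x, `|x| < d -> `|partial (b i) ord0 x| <= K i.
Proof.
have [i|i d d' d'0 dd [K HK]|d d0 HK] := @common_pos R m.+1
  (fun i d => exists K, forall x, `|x| < d -> `|partial (b i) ord0 x| <= K).
- have : analytic_at (partial (b i) ord0) 0.
    by apply: analytic_partial; apply: ba; rewrite normr0.
  move=> /analytic_atP[d [M [d0 HM]]]; exists d => //; exists M => x xd.
  by apply: (majorized_le d0 HM); rewrite subr0.
- by exists K => x xd; apply: HK; exact: lt_le_trans dd.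
have {HK}/choice[K HK] := HK.
exists (Num.min d r); first by rewrite lt_min d0 r0 /= ge_min lexx orbT.
by exists K => i x; rewrite lt_min => /andP[xd _]; exact: HK.
Qed.

(** The field [b] is not known to be constant on the segment, but by the Burgers equation [g t], the
    product of [w] with [b (x0 + t w)], solves a linear equation [g' = k g]. It vanishes at [0],
    hence throughout, and the derivative of [partial u j] along [w] is a multiple of [g]. *)
Lemma gradient_characteristic : exists2 e : R, 0 < e & forall x0 w : 'rV[R]_m.+1,
  `|x0| + `|w| < e -> \sum_(i < m.+1) w 0 i * b i x0 = 0 ->
  forall j, partial u j (x0 + w) = partial u j x0.
Proof.
have [d /andP[d0 dr] [K HK]] := bounded_speed.
exists d => // x0 w xw gw j.
have nl t : 0 <= t <= 1 -> `|x0 + t *: w| < d.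
  move=> /andP[t0 t1]; apply: le_lt_trans xw; apply: (le_trans (ler_normD _ _)).
  by rewrite lerD2l normrZ ger0_norm // ler_piMl.
have nr t : 0 <= t <= 1 -> `|x0 + t *: w| < r by move=> /nl /lt_le_trans; exact.
pose g t := \sum_(i < m.+1) w 0 i * b i (x0 + t *: w).
pose k t := \sum_(i < m.+1) w 0 i * partial (b i) ord0 (x0 + t *: w).
have g0 t : 0 <= t <= 1 -> g t = 0.
  apply: (@linear_ode0 R g k (\sum_(i < m.+1) `|w 0 i| * K i)).
  - move=> {}t t01; have Db i : is_derive t 1 (fun s => w 0 i * b i (x0 + s *: w))
        (w 0 i * partial (b i) ord0 (x0 + t *: w) * g t).
      have := is_derive_mul (is_derive_cst (w 0 i) t 1)
        (analytic_line_derive (ba i (nr _ t01))).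
      rewrite mul0r add0r /cst.
      rewrite [X in is_derive _ _ _ X](_ : _ = w 0 i * partial (b i) ord0 (x0 + t *: w) * g t) //.
      rewrite -mulrA; congr (_ * _); rewrite /g mulr_sumr; apply: eq_bigr => l _.
      by rewrite (burgers i l (nr _ t01)); ring.
    by rewrite /k mulr_suml; exact: is_derive_bigsum.
  - move=> {}t t01; apply: (le_trans (ler_norm_sum _ _ _)); apply: ler_sum => i _.
    by rewrite normrM ler_wpM2l //; apply: HK; exact: nl.
  - by rewrite /g; under eq_bigr do rewrite scale0r addr0.
pose f t := partial u j (x0 + t *: w).
have : f 1 = f 0.
  apply: derive0_eq => t t01.
  have := analytic_line_derive (analytic_partial j (u_analytic (nr _ t01))).
  rewrite [X in is_derive _ _ _ X](_ : _ = 0) //.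
  transitivity (H ord0 ord0 (x0 + t *: w) * b j (x0 + t *: w) * g t).
    rewrite /g mulr_sumr; apply: eq_bigr => i _.
    by rewrite -H_def (HE j i (nr _ t01)); ring.
  by rewrite g0 // mulr0.
by rewrite /f scale1r scale0r addr0.
Qed.

End Characteristics.

Lemma developable_gradient (u : 'rV[R]_m.+1 -> R) (r : R) : 0 < r ->
  (forall x, `|x| < r -> analytic_at u x) ->
  (forall x, `|x| < r -> exists beta delta : 'I_m.+1 -> R,
    forall i j, partial (partial u i) j x = beta j * delta i) ->
  (forall i t, `|t| < r -> partial u i (@on_axis R m t) = q i t) ->
  exists2 e : R, 0 < e & forall x t, `|x| < e -> `|t| < e ->
    t = \sum_(i < m.+1) x 0 i * slope i t -> forall j, partial u j x = q j t.
Proof.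
move=> r0 ua hr uq.
have pa i x : `|x| < r -> analytic_at (partial u i) x.
  by move=> xr; apply: analytic_partial; exact: ua.
have Hq i t : `|t| < r -> partial (partial u i) ord0 (@on_axis R m t) = 'D_1 (q i) t.
  by move=> tr; apply: (@partial_axis _ _ r) => //; [exact: pa|exact: uq].
have z : `|0 : 'rV[R]_m.+1| < r by rewrite normr0.
have H00 : partial (partial u ord0) ord0 0 != 0.
  have -> : 0 = @on_axis R m 0 by rewrite /on_axis scale0r.
  by rewrite Hq ?normr0 // q0'0 oner_neq0.
have [r1 r10 Hn] := analytic_neq0_near (analytic_partial ord0 (pa ord0 _ z)) H00.
pose r' := Num.min r r1.
have r'0 : 0 < r' by rewrite lt_min r0.
have r'P (V : normedModType R) (x : V) : `|x| < r' -> `|x| < r /\ `|x| < r1.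
  by rewrite lt_min => /andP[].
have Hn' x : `|x| < r' -> partial (partial u ord0) ord0 x != 0.
  by move=> /r'P[_ x1]; apply: Hn; rewrite subr0.
have [||e e0 He] := @gradient_characteristic u r' r'0 _ _ Hn' _ _ (fun _ _ => erefl) (fun=> erefl).
- by move=> x /r'P[xr _]; exact: ua.
- by move=> x /r'P[xr _]; exact: hr.
(* With [x0 = (t, 0)] and [w = x - x0] one has [|x0| + |w| <= 2 |t| + |x| < 3 e / 4]. *)
exists (Num.min (e / 4) r'); first by rewrite lt_min divr_gt0.
move=> x t; rewrite !lt_min => /andP[xe _] /andP[te /andP[tr tr1]] E j.
have ta := norm_on_axis t.
have tr' : `|@on_axis R m t| < r' by rewrite lt_min !(le_lt_trans ta).
rewrite -(uq j) // -[in LHS](subrK (@on_axis R m t) x) addrC; apply: He.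
  have := ler_normB x (@on_axis R m t).
  by lra.
have q0t : 'D_1 (q ord0) t != 0.
  by apply: contraNneq (Hn' _ tr') => q0; apply/eqP; exact: (etrans (Hq ord0 t tr) q0).
rewrite (eq_bigr (fun i => x 0 i * slope i t - @on_axis R m t 0 i * slope i t)); last first.
  move=> i _; rewrite -mulrBl !mxE; congr (_ * _).
  exact: (f_equal2 (fun y z => y / z) (Hq i t tr) (Hq ord0 t tr)).
rewrite sumrB -E (bigD1 ord0) //= big1 ?addr0; last first.
  by move=> i /negbTE i0; rewrite on_axisE i0 mulr0 mul0r.
by rewrite on_axisE eqxx mulr1 /slope divff // mulr1 subrr.
Qed.

End Developable.

(** * The Gauss map *)

Section GaussMap.
Variables (R : realType) (m : nat).
Implicit Types (u : 'rV[R]_m.+1 -> R) (x : 'rV[R]_m.+1).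

Lemma normalN_max u x : normalN u x 0 ord_max = -1.
Proof. by rewrite mxE unlift_none. Qed.

Lemma normalN_lift u x i : normalN u x 0 (lift ord_max i) = partial u i x.
Proof. by rewrite mxE liftK. Qed.

Definition gauss_scale u x := (Num.sqrt (sqnorm (normalN u x)))^-1.

Lemma sqnorm_normalN_gt0 u x : 0 < sqnorm (normalN u x).
Proof.
rewrite /sqnorm (bigD1 ord_max) //= normalN_max sqrrN expr1n ltr_wpDr //.
by apply: sumr_ge0 => i _; exact: sqr_ge0.
Qed.

Lemma gauss_scale_gt0 u x : 0 < gauss_scale u x.
Proof. by rewrite invr_gt0 sqrtr_gt0 sqnorm_normalN_gt0. Qed.

Lemma gaussE u x k : gauss u x 0 k = gauss_scale u x * normalN u x 0 k.
Proof. by rewrite mxE. Qed.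

(** Central projection of the lower half sphere: the last entry of the normal is [-1], so minus the
    ratios of entries of the unit normal recover the gradient. *)
Definition curve_gradient (gamma : R -> 'rV[R]_m.+2) i t :=
  - (gamma t 0 (lift ord_max i) / gamma t 0 ord_max).

Lemma gradient_of_gauss u x gamma t j : gauss u x = gamma t ->
  partial u j x = curve_gradient gamma j t.
Proof.
move=> E; rewrite /curve_gradient -E !gaussE normalN_max normalN_lift.
by field; rewrite gt_eqF // gauss_scale_gt0.
Qed.

(** Equal ratios determine a unit vector only up to sign; the negative last entry selects the sign
    of the Gauss map. *)
Lemma gauss_of_gradient u x gamma t : sqnorm (gamma t) = 1 -> gamma t 0 ord_max < 0 ->
  (forall j, partial u j x = curve_gradient gamma j t) -> gauss u x = gamma t.
Proof.
move=> g1 gm E; pose c := - (gamma t 0 ord_max)^-1.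
have c0 : 0 < c by rewrite oppr_gt0 invr_lt0.
have N : normalN u x = c *: gamma t.
  apply/rowP => k; rewrite [RHS]mxE; case: (unliftP ord_max k) => [i|] ->.
    by rewrite normalN_lift E /curve_gradient /c mulNr mulrC.
  by rewrite normalN_max /c mulNr mulVf // lt_eqF.
have S : sqnorm (normalN u x) = c ^+ 2.
  rewrite N /sqnorm; under eq_bigr do rewrite mxE exprMn.
  by rewrite -mulr_sumr -/(sqnorm (gamma t)) g1 mulr1.
by rewrite /gauss S sqrtr_sqr gtr0_norm // N scalerA mulVf ?gt_eqF // scale1r.
Qed.

Lemma rank1_factor (p n : nat) (A : 'M[R]_(p, n)) : \rank A = 1%N ->
  exists (al : 'I_p -> R) (be : 'I_n -> R), forall i j, A i j = al i * be j.
Proof.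
move=> rk; have := mulmx_base A; move: (col_base A) (row_base A); rewrite rk => C B E.
by exists (fun i => C i 0), (fun j => B 0 j) => i j; rewrite -E mxE big_ord1.
Qed.

Lemma rank1_outer (p n : nat) (A : 'M[R]_(p, n)) (al : 'I_p -> R) (be : 'I_n -> R) i0 j0 :
  (forall i j, A i j = al i * be j) -> al i0 != 0 -> be j0 != 0 -> \rank A = 1%N.
Proof.
move=> E a0 b0.
have AE : A = (\col_i al i) *m (\row_j be j).
  by apply/matrixP => i j; rewrite E !mxE big_ord1 !mxE.
apply/eqP; rewrite eqn_leq; apply/andP; split; first by rewrite AE mulmx_max_rank.
rewrite lt0n mxrank_eq0; apply/eqP => A0.
by move: (E i0 j0); rewrite A0 mxE => /esym/eqP; rewrite mulf_eq0 (negbTE a0) (negbTE b0).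
Qed.

(** Write the Gauss map as [w N] with [w] the inverse length. Its last entry [- w] gives the
    derivatives of [w] in terms of [al] and [be]; eliminating them from those of [w * partial u i]
    leaves [w] times the Hessian, with the factor [be j] throughout. *)
Lemma hessian_rank1 u x : analytic_at u x -> \rank (gauss_jacobian u x) = 1%N ->
  exists beta delta : 'I_m.+1 -> R,
    forall i j, partial (partial u i) j x = beta j * delta i.
Proof.
move=> ua /rank1_factor[al [be E]].
have pa i : analytic_at (partial u i) x by exact: analytic_partial.
have Wa : analytic_at (fun y => sqnorm (normalN u y)) x.
  apply: analytic_sum => k.
  have Na : analytic_at (fun y => normalN u y 0 k) x.
    under eq_fun do rewrite mxE.
    by case: (unlift ord_max k) => [i|]; [exact: pa|exact: analytic_cst].
  by under eq_fun do rewrite expr2; exact: analyticM.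
have Dw j : exists d, is_derive x (evec R j) (gauss_scale u) d.
  have D1 := analytic_derive_partial j Wa.
  have D2 := is_derive_chain D1 (is_derive1_sqrt (sqnorm_normalN_gt0 u x)).
  have s0 : Num.sqrt (sqnorm (normalN u x)) != 0.
    by rewrite gt_eqF // sqrtr_gt0 sqnorm_normalN_gt0.
  have [D3 _] := analytic1_derive (analytic1_inv s0).
  by eexists; exact: (is_derive_chain D2 D3).
have w0 : gauss_scale u x != 0 by rewrite gt_eqF // gauss_scale_gt0.
exists be, (fun i => (al (lift ord_max i) + partial u i x * al ord_max) / gauss_scale u x).
move=> i j; have [d D] := Dw j.
have E1 : al ord_max * be j = - d.
  rewrite -E mxE.
  have := is_derive_mul D (is_derive_cst (-1 : R) x (evec R j)).
  rewrite /cst mulrN1 mulr0 addr0 => -[_ <-]; congr ('D_ _ _ _).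
  by apply/funext => y; rewrite gaussE normalN_max.
have E2 : al (lift ord_max i) * be j =
    d * partial u i x + gauss_scale u x * partial (partial u i) j x.
  rewrite -E mxE.
  have [_ <-] := is_derive_mul D (analytic_derive_partial j (pa i)); congr ('D_ _ _ _).
  by apply/funext => y; rewrite gaussE normalN_lift.
apply: (mulfI w0); rewrite mulrCA [_ * (_ / _)]mulrC divfK // mulrDr.
rewrite [be j * _]mulrC E2 [be j * (_ * _)]mulrCA [be j * _]mulrC E1; ring.
Qed.

End GaussMap.

(** * Existence and uniqueness for the prescribed curve *)

Section Curve.
Variables (R : realType) (m : nat) (gamma : R -> 'rV[R]_m.+2).
Hypothesis gamma_sphere : analytic_sphere_curve gamma.
Hypothesis gamma0 : gamma 0 = - evec R (@ord_max m.+1).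
Hypothesis gamma'0 : 'D_1 gamma 0 = evec R (@ord0 m.+1).

Let gamma_analytic j t : -1 < t < 1 -> analytic_at1 (fun s => gamma s 0 j) t.
Proof. by move=> t1; have [_ H] := gamma_sphere; exact: H. Qed.

Let unit0 : -1 < (0 : R) < 1.
Proof. by rewrite ltr01 ltrN10. Qed.

Lemma gamma0_max : gamma 0 0 ord_max = -1.
Proof. by rewrite gamma0 !mxE eqxx. Qed.

Lemma gamma0_lift i : gamma 0 0 (lift ord_max i) = 0.
Proof. by rewrite gamma0 !mxE eq_sym (negbTE (neq_lift _ _)) oppr0. Qed.

Lemma gamma_derive0 j : 'D_1 (fun s => gamma s 0 j) 0 = (j == ord0)%:R.
Proof.
have D : derivable gamma 0 1.
  apply/derivable_mxP => i k; rewrite (ord1 i).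
  by have [[D _] _] := analytic1_derive (gamma_analytic k unit0).
by have := gamma'0; rewrite (derive_mx D) => /rowP/(_ j); rewrite !mxE.
Qed.

Lemma curve_gradient_analytic i : analytic_at1 (curve_gradient gamma i) 0.
Proof.
have -> : curve_gradient gamma i = fun t =>
    (-1) * (gamma t 0 (lift ord_max i) * (gamma t 0 ord_max)^-1).
  by apply/funext => t; rewrite mulN1r.
apply: analytic1M; first exact: analytic1_cst.
apply: analytic1M; first exact: gamma_analytic.
apply: analytic1V; last exact: gamma_analytic.
by rewrite gamma0_max oppr_eq0 oner_neq0.
Qed.

(** The first entry of [gamma 0] vanishes, so the derivative of the denominator drops out of the
    quotient rule. *)
Lemma curve_gradient_derive0 : 'D_1 (curve_gradient gamma ord0) 0 = 1.
Proof.
have gm0 : gamma 0 0 ord_max != 0 by rewrite gamma0_max oppr_eq0 oner_neq0.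
have [D1 _] := analytic1_derive (gamma_analytic (lift ord_max ord0) unit0).
have [D2 _] := analytic1_derive (gamma_analytic ord_max unit0).
have := is_derive_sub (is_derive_cst (0 : R) (0 : R) 1)
  (is_derive_mul D1 (is_deriveV gm0 D2)).
rewrite gamma0_lift mul0r addr0 gamma_derive0 gamma0_max.
have -> : (lift ord_max ord0 == ord0 :> 'I_m.+2) by apply/eqP/val_inj.
move=> [_]; rewrite mul1r sub0r invrN invr1 opprK => E; apply: etrans E; congr ('D_ _ _ _).
by apply/funext => t; rewrite /cst sub0r.
Qed.

Lemma curve_near : exists2 e : R, 0 < e & forall t, `|t| < e ->
  [/\ -1 < t < 1, gamma t 0 ord_max < 0 & 'D_1 (fun s => gamma s 0 ord0) t != 0].
Proof.
have /analytic1_continuous c := gamma_analytic ord_max unit0.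
have : \forall t \near (0 : R), gamma t 0 ord_max < 0.
  by apply: (cvgr_lt _ c); rewrite gamma0_max ltrN10.
move=> /nbhs_ballP[e1 /= e10 H1].
have [_ A] := analytic1_derive (gamma_analytic ord0 unit0).
have [|e2 e20 H2] := analytic1_neq0_near A; first by rewrite gamma_derive0 oner_neq0.
exists (Num.min 1 (Num.min e1 e2)); first by rewrite !lt_min ltr01 e10.
move=> t; rewrite !lt_min => /and3P[t1 te1 te2]; split.
- by rewrite -ltr_norml.
- by apply: H1; rewrite /ball /= sub0r normrN.
- by apply: H2; rewrite subr0.
Qed.

(** Near [0] the Gauss map is [gamma (s x)], so its Jacobian is the outer product of [gamma'] at
    [s x] and the gradient of [s]; the entry of index [0] of each factor is nonzero. *)
Lemma solution_exists : exists u r, is_solution gamma u r.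
Proof.
have [e e0 ce] := curve_near.
have [u [s [r [r0 u0 us up sax]]]] :=
  developable_exists curve_gradient_analytic curve_gradient_derive0 e0.
have gE x : `|x| < r -> gauss u x = gamma (s x).
  move=> xr; have [_ _ se _] := us _ xr; have [s1 sm _] := ce _ se.
  apply: gauss_of_gradient => //; last by move=> j; exact: up.
  by have [H _] := gamma_sphere; exact: H.
exists u, r; split => //.
- by move=> x /us[].
- move=> x xr; have [_ sa se ds] := us _ xr; have [s1 _ dg] := ce _ se.
  apply: (@rank1_outer _ _ _ _ (fun k => 'D_1 (fun t => gamma t 0 k) (s x))
    (fun i => partial s i x) ord0 ord0) => // k i; rewrite mxE.
  have [D _] := analytic1_derive (gamma_analytic k s1).
  have [_ <-] := is_derive_chain (analytic_derive_partial i sa) D.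
  apply: (@partial_near_eq _ _ _ _ r) => // y yr.
  by rewrite gE.
- move=> t tr; rewrite gE ?sax //.
  by apply: le_lt_trans tr; exact: norm_on_axis.
Qed.

Lemma solution_gradient u r : is_solution gamma u r -> exists2 e : R, 0 < e &
  forall (x : 'rV[R]_m.+1) t, `|x| < e -> `|t| < e ->
    t = \sum_(i < m.+1) x 0 i * slope (curve_gradient gamma) i t ->
    forall j, partial u j x = curve_gradient gamma j t.
Proof.
move=> [r0 _ ua rk ax].
apply: (@developable_gradient _ _ _ curve_gradient_derive0 u r) => //.
- by move=> x xr; apply: hessian_rank1; [exact: ua|exact: rk].
- by move=> i t tr; apply: gradient_of_gauss; exact: ax.
Qed.

(** Both gradients at [x] equal the prescribed one at the same parameter, the solution of the
    implicit equation, which depends on [gamma] alone. Integration along the ray from [0], where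
    both functions vanish, finishes. *)
Lemma solution_unique u v r s : is_solution gamma u r -> is_solution gamma v s ->
  exists rho : R, 0 < rho /\ forall x, `|x| < rho -> u x = v x.
Proof.
move=> su sv; have [eu eu0 Hu] := solution_gradient su.
have [ev ev0 Hv] := solution_gradient sv.
have e0 : 0 < Num.min eu ev by rewrite lt_min eu0.
have [t [d [tau [d0 /andP[_ taue] _ tE _]]]] := implicit_parameter
  (slope_analytic curve_gradient_analytic curve_gradient_derive0) e0.
move: su sv => [r0 u0 ua _ _] [s0 v0 va _ _].
set rho := Num.min (Num.min r s) (Num.min d (Num.min eu ev)).
have rhoP y : `|y| < rho -> [/\ analytic_at u y, analytic_at v y &
    forall j, partial u j y = partial v j y].
  rewrite !lt_min => /andP[/andP[yr ys] /and3P[yd yeu yev]].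
  split; [exact: ua|exact: va|move=> j].
  have [/le_lt_trans /(_ taue)] := tE _ yd; rewrite lt_min => /andP[teu tev] ty.
  exact: (etrans (Hu _ _ yeu teu ty j) (esym (Hv _ _ yev tev ty j))).
exists rho; split; first by rewrite !lt_min r0 s0 d0 eu0.
move=> x xrho.
have : u (0 + 1 *: x) - v (0 + 1 *: x) = u (0 + 0 *: x) - v (0 + 0 *: x).
  apply: (@derive0_eq _ (fun a => u (0 + a *: x) - v (0 + a *: x))) => a /andP[a0 a1].
  have /rhoP[uy vy E] : `|0 + a *: x| < rho.
    rewrite add0r normrZ ger0_norm //; apply: le_lt_trans xrho.
    by rewrite ler_piMl.
  have := is_derive_sub (analytic_line_derive uy) (analytic_line_derive vy).
  rewrite -sumrB big1 // => i _; apply/eqP; rewrite subr_eq0; apply/eqP.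
  by congr (_ * _); exact: E.
by rewrite !add0r scale1r scale0r u0 v0 subrr => /eqP; rewrite subr_eq0 => /eqP.
Qed.

End Curve.

(* Paper's n = m.+1 (n >= 1 is needed for the coordinate x^1);
   sphere S^n lives in R^(n+1) = 'rV_(m.+2). *)
Theorem theorem1p6 (R : realType) (m : nat) (gamma : R -> 'rV[R]_m.+2) :
  analytic_sphere_curve gamma ->
  gamma 0 = - evec R (@ord_max m.+1) ->
  'D_1 gamma 0 = evec R (@ord0 m.+1) ->
  (exists u : 'rV[R]_m.+1 -> R, exists r : R, is_solution gamma u r) /\
  (forall (u v : 'rV[R]_m.+1 -> R) (r s : R),
      is_solution gamma u r -> is_solution gamma v s ->
      exists rho : R, 0 < rho /\
        forall x : 'rV[R]_m.+1, `|x| < rho -> u x = v x).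
Proof.
move=> sph g0 g'0; split; first exact: solution_exists.
by move=> u v r s; exact: solution_unique.
Qed.
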